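(* Let $k$ be an algebraically closed field, $n\ge 2$ and $G=\mathrm{GL}_n(k)$. Let $\mu$ be a partition of $n$, let $C=\overline{\mathcal O}_\mu\subseteq\mathfrak{gl}_n(k)$ be the closure of the nilpotent orbit $\mathcal O_\mu$, and let $\lambda$ be a partition of $r$ with length $l(\lambda)\le n-1$. Then the vector space $k[C]^U_{[(r),\lambda]}$ is nonzero if and only if $l(\lambda)\le\mu_1-1$. The same holds for the vector space $k[C]^U_{[\lambda,(r)]}$. Furthermore the following hold. (i) The restrictions $\tilde u_T|_C$, $T$ running over the semi-standard tableaux of shape $\lambda$ with entries in $\{1,\ldots,\mu_1-1\}$, form a basis of the $k$-vector space $k[C]^U_{[(r),\lambda]}$. (ii) The restrictions $\tilde v_T|_C$, $T$ running over the semi-standard tableaux of shape $\lambda$ with entries in $\{1,\ldots,\mu_1-1\}$, form a basis of the $k$-vector space $k[C]^U_{[\lambda,(r)]}$.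
   Context: **Orbits.** For a partition $\mu=(\mu_1\ge\mu_2\ge\cdots\ge\mu_m)$ of $n$, $\mathcal O_\mu$ is the set of nilpotent $n\times n$ matrices over $k$ whose Jordan normal form has blocks of sizes $\mu_1,\ldots,\mu_m$; it is a single orbit for the conjugation action of $G$. $\overline{\mathcal O}_\mu$ is its Zariski closure (a closed subvariety with its reduced structure) and $k[C]$ is its algebra of regular functions. **Group actions and weights.** $G$ acts on $C$ by conjugation and on $k[C]$ by $(g\cdot f)(A)=f(g^{-1}Ag)$. $U\subseteq G$ is the subgroup of upper unitriangular matrices and $H\subseteq G$ the subgroup of invertible diagonal matrices. Characters of $H$ (''weights'') are identified with elements of $\mathbb Z^n$: $\chi=(\chi_1,\ldots,\chi_n)$ corresponds to $S\mapsto\prod_i S_{ii}^{\chi_i}$. For a weight $\chi$, $k[C]^U_\chi$ is the space of $f\in k[C]$ that are fixed by $U$ and satisfy $S\cdot f=\chi(S)f$ for all $S\in H$. **Partitions and tableaux.** Partitions of length $\le n$ (length = number of nonzero parts) are regarded as elements of $\mathbb Z^n$ by extending with zeros. For $\lambda,\nu\in\mathbb Z^n$, $[\lambda,\nu]=\lambda-\nu^{\rm rev}$, where $\nu^{\rm rev}$ is the reversed $n$-tuple. $(r)$ is the partition with single part $r$ (viewed as $(r,0,\ldots,0)\in\mathbb Z^n$). The shape of $\lambda$ is $\{(i,j)\mid 1\le i\le l(\lambda),\,1\le j\le\lambda_i\}$; a tableau of shape $\lambda$ with entries in a set $I$ of integers is a function from this shape to $I$, with rows and columns as for matrices. It is semi-standard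 if its entries are strictly increasing down the columns and weakly increasing in the rows from left to right. **The semi-invariants.** Let $e_1,\ldots,e_n$ be the standard basis of $k^n$ and let $A'$ denote the transpose of $A$. For a one-column tableau $T$ of length $l$ with entries $t_1,\ldots,t_l\in\{1,\ldots,n-1\}$ (from top to bottom) define functions on $\mathfrak{gl}_n$ by $$\tilde u_T(A)=\det\big(A^{t_1}(e_1)|\cdots|A^{t_l}(e_1)\big)_{l\ge},\qquad \tilde v_T(A)=\det\big(A'^{\,t_1}(e_n)|\cdots|A'^{\,t_l}(e_n)\big)_{l\le},$$ where the subscripts ''$l\ge$'' and ''$l\le$'' mean that one takes the last, respectively first, $l$ rows of the $n\times l$ matrix before taking the determinant. For an arbitrary tableau $T$ of shape $\lambda$ with entries in $\{1,\ldots,n-1\}$ and columns $T^1,\ldots,T^{\lambda_1}$, define $\tilde u_T=\prod_i\tilde u_{T^i}$ and $\tilde v_T=\prod_i\tilde v_{T^i}$ (empty products are $1$). *)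

(* Defs.v *)
From HB Require Import structures.
From mathcomp Require Import all_boot all_order all_algebra.
From mathcomp Require Import boolp classical_sets functions.
From mathcomp Require Import mpoly.

Set Implicit Arguments.
Unset Strict Implicit.
Unset Printing Implicit Defensive.

Import GRing.Theory.
Local Open Scope classical_set_scope.
Local Open Scope ring_scope.

(* A partition is the weakly decreasing sequence of its nonzero parts, so its
   length is its size and its first part is [head 0 s]. *)
Definition is_partition (n : nat) (s : seq nat) : bool :=
  [&& sorted geq s, 0%N \notin s & sumn s == n].

Section Varieties.

Variables (k : closedFieldType) (n : nat).

(* Polynomial functions on n x n matrices: one variable per entry, in the
   row-major order of [mxvec]. *)
Definition peval (p : {mpoly k[n * n]}) (A : 'M[k]_n) : k :=
  p.@[fun i => mxvec A 0 i].

Definition zariski_closed (Z : set 'M[k]_n) : Prop :=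
  exists S : set {mpoly k[n * n]}, Z = [set A | forall p, S p -> peval p A = 0].

(* The coordinate ring k[C] of a closed C, as functions on the points of C; it
   is a subset of the k-vector space of all functions from C to k. *)
Definition regular (C : set 'M[k]_n) : set (C -> k^o) :=
  [set f | exists p, forall A : C, f A = peval p (val A)].

Definition GL := {g : 'M[k]_n | g \in unitmx}.

(* The action of g^-1 by conjugation. *)
Definition conjV (g : GL) (A : 'M[k]_n) : 'M[k]_n :=
  invmx (val g) *m A *m val g.

(* Block-diagonal with nilpotent Jordan blocks of sizes mu_1, mu_2, ...:
   [reshape_index mu i] is the index of the block containing i. *)
Definition jordan_nilp (mu : seq nat) : 'M[k]_n :=
  \matrix_(i, j) ((j == i.+1 :> nat) &&
                  (reshape_index mu i == reshape_index mu j))%:R.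

Definition orbit (mu : seq nat) : set 'M[k]_n :=
  [set A | exists g : GL, A = conjV g (jordan_nilp mu)].

Definition orbit_closure (mu : seq nat) : set 'M[k]_n :=
  smallest zariski_closed (orbit mu).

Lemma peval_conjV (g : GL) (p : {mpoly k[n * n]}) :
  exists q, forall A, peval q A = peval p (conjV g A).
Proof.
pose L := lin_mx (mulmxr (val g) \o mulmx (invmx (val g)))%R.
exists (comp_mpoly [tuple \sum_j L j i *: 'X_j | i < n * n] p) => A.
rewrite /peval comp_mpoly_meval; apply: meval_eq => i.
rewrite tnth_mktuple raddf_sum /=.
have -> : mxvec (conjV g A) = mxvec A *m L by rewrite mul_vec_lin.
by rewrite mxE; apply: eq_bigr => j _; rewrite mevalZ mevalXU mulrC.
Qed.

Lemma orbit_conjV mu (g : GL) (A : 'M[k]_n) :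
  orbit mu A -> orbit mu (conjV g A).
Proof.
case=> h ->; have hg : val h *m val g \in unitmx.
  by rewrite unitmx_mul (valP h) (valP g).
exists (Sub (val h *m val g) hg : GL); rewrite /conjV /=; suff -> : invmx (val h *m val g) =
  invmx (val g) *m invmx (val h) by rewrite !mulmxA.
apply: (can_inj (mulKmx hg)).
by rewrite mulmxV // mulmxA -(mulmxA (val h)) mulmxV ?(valP g) // mulmx1
  mulmxV // (valP h).
Qed.

Lemma orbit_closure_conjV mu (g : GL) (A : 'M[k]_n) :
  A \in orbit_closure mu -> conjV g A \in orbit_closure mu.
Proof.
rewrite !inE => clA Z [[S ->] sub] p Sp.
have [q qE] := peval_conjV g p; rewrite -qE.
apply: (clA [set B | peval q B = 0]); split=> [|B OB] /=.
  exists [set q]; apply/seteqP; split=> B /= => [? _ -> //|]; exact.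
by rewrite qE; apply: sub Sp; apply: orbit_conjV.
Qed.

(* (g . f)(A) = f (g^-1 A g) *)
Definition act mu (g : GL) (f : orbit_closure mu -> k^o) :
    orbit_closure mu -> k^o :=
  fun A => f (exist _ (conjV g (val A)) (orbit_closure_conjV g (valP A))).

Definition unitriangular (u : GL) : bool :=
  [forall i : 'I_n, forall j : 'I_n, (j <= i)%N ==> (val u i j == (i == j)%:R)].

Definition character (chi : 'rV[int]_n) (s : GL) : k :=
  \prod_i val s i i ^ chi 0 i.

(* k[C]^U_chi for C = orbit_closure mu *)
Definition semi_invariants mu (chi : 'rV[int]_n) :
    set (orbit_closure mu -> k^o) :=
  [set f | [/\ regular f,
               forall u : GL, unitriangular u -> act u f = f &
               forall s : GL, is_diag_mx (val s) ->
                 act s f = character chi s *: f]].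

End Varieties.

Arguments orbit_closure k n mu : clear implicits.
Arguments semi_invariants k n mu chi : clear implicits.

Definition part_weight (n : nat) (s : seq nat) : 'rV[int]_n :=
  \row_i (nth 0%N s i)%:Z.

Definition bracket (n : nat) (a b : 'rV[int]_n) : 'rV[int]_n :=
  \row_i (a 0 i - b 0 (rev_ord i)).

(* The boxes (i, j) of the shape of lam, with rows and columns numbered
   from 0. *)
Definition box (lam : seq nat) :=
  {ij : 'I_(size lam) * 'I_(head 0%N lam) | (ij.2 < nth 0 lam ij.1)%N}.

HB.instance Definition _ lam := SubFinite.on (box lam).

Section Tableaux.

Variable lam : seq nat.
Implicit Type T : box lam -> nat.

Definition semistandard T : bool :=
  [forall b : box lam, forall c : box lam,
     [&& (val b).1 == (val c).1 & ((val b).2 <= (val c).2)%N]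
       ==> (T b <= T c)%N]
  && [forall b : box lam, forall c : box lam,
     [&& (val b).2 == (val c).2 & ((val b).1 < (val c).1)%N]
       ==> (T b < T c)%N].

(* The semi-standard tableaux of shape lam with entries in {1, ..., m}. *)
Definition ssyt (m : nat) :=
  {T : {ffun box lam -> 'I_m.+1} |
     [forall b, (0 < T b)%N] && semistandard (fun b => T b)}.

HB.instance Definition _ m := SubFinite.on (ssyt m).

Definition ssyt_entry (m : nat) (T : ssyt m) (b : box lam) : nat := val T b.

(* The entries of the j-th column, from top to bottom. *)
Definition column T (j : 'I_(head 0%N lam)) : seq nat :=
  pmap (fun i => omap T (insub (i, j))) (enum 'I_(size lam)).

End Tableaux.

Section SemiInvariants.

Variables (k : closedFieldType) (n : nat).
Implicit Types (A : 'M[k]_n) (t : seq nat).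

Definition e_first : 'cV[k]_n := \col_i (i == 0%N :> nat)%:R.
Definition e_last : 'cV[k]_n := \col_i (i == n.-1 :> nat)%:R.

(* The (A^{t_1} v | ... | A^{t_l} v) of the one-column tableau t. *)
Definition power_mx t A (v : 'cV[k]_n) : 'M[k]_(n, size t) :=
  \matrix_(i, j) (A ^+ nth 0%N t j *m v) i 0.

(* The square matrix whose rows are the rows d, d + 1, ..., d + l - 1 of M; rows
   of index >= n, which do not occur when d + l <= n, are read as zero. *)
Definition row_window (l d : nat) (M : 'M[k]_(n, l)) : 'M[k]_l :=
  \matrix_(i, j) oapp (fun i' : 'I_n => M i' j) 0 (insub (d + i)%N).

Definition u_col t A : k :=
  \det (row_window (n - size t) (power_mx t A e_first)).

Definition v_col t A : k :=
  \det (row_window 0 (power_mx t A^T e_last)).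

Definition u_tilde lam (T : box lam -> nat) A : k :=
  \prod_(j < head 0%N lam) u_col (column T j) A.

Definition v_tilde lam (T : box lam -> nat) A : k :=
  \prod_(j < head 0%N lam) v_col (column T j) A.

Definition restr (C : set 'M[k]_n) (f : 'M[k]_n -> k) : C -> k^o :=
  fun x => f (val x).

End SemiInvariants.

Arguments restr {k n} C f _.

Definition is_basis (k : fieldType) (V : lmodType k) (W : set V)
    (I : finType) (b : I -> V) : Prop :=
  [/\ forall i, W (b i),
      forall c : I -> k, \sum_i c i *: b i = 0 -> forall i, c i = 0 &
      forall v, W v -> exists c : I -> k, v = \sum_i c i *: b i].

(* Main.v *)
Require Import Defs.
From mathcomp Require Import all_boot all_order all_algebra.
From mathcomp Require Import boolp classical_sets functions.
From mathcomp Require Import perm mpoly ring zify.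

(** Let n = p + 1, let m be the largest part of mu minus 1, and let N be the
    transposed nilpotent Jordan matrix of type mu; N moves the first basis
    vector e through the first block, which has m + 1 elements, and stabilizes
    the span of the other blocks.

    Reduction to a slice.  For g in GL_p put D = diag(1, g).  A matrix in the
    orbit of N is x N x^-1, and for almost every x an element of the centralizer
    of N corrects x so that it fixes e; then x is the product of a unitriangular
    matrix and some D.  Hence a U-invariant function on the closure of the orbit
    is determined by its values on the matrices D N D^-1 ([extend_closure]).  On
    these, N^t e is a basis vector for t <= m, so the function of a tableau T is,
    up to a sign that only depends on the shape, the bideterminant of T in the
    first m columns of g ([u_tilde_slice]).

    Semi-invariants of matrices.  As a function of g, a semi-invariant f of
    weight [(r), lambda] is fixed by the unitriangular row operations and has
    row weight lambda, and a power of det g clears its denominators.  It remains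
    to know that, in every characteristic, the polynomial functions of a
    matrix that are fixed by the unipotent row operations and have weight lambda
    have the bideterminants of the semi-standard tableaux of shape lambda as a
    basis ([row_semi_span], [bidet_indep]).  This is shown by letting the matrix
    entries become available one at a time, so that the newest entry y is itself
    a semi-invariant: putting y to 0 removes the tableaux that have the
    newest value in the newest row, and division by y removes a box from the
    shape.  That division leads to no weights other than partitions is a fact on
    SL2 ([row_semi_dominant]).

    Back to f.  The power of the determinant corresponds to full columns of the
    tableaux and cancels ([bispan_divide]).  The torus that scales all blocks of
    N but the first by t centralizes N, so f does not change when the columns of
    g beyond the first m are multiplied by t; for t = 0 this leaves the tableaux
    with entries at most m ([slice_span]).  They are independent because the
    first m columns of an invertible g are arbitrary up to closure ([u_indep]).

    The second family is the image of the first under the reflection of matrices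
    in the second diagonal ([semi_antitr], [u_tilde_antitr]).  A weight space is
    nonzero when its basis is not empty, that is when a semi-standard tableau
    with entries at most m exists, which means that the first column of lambda
    has length at most m. *)

Set Implicit Arguments.
Unset Strict Implicit.
Unset Printing Implicit Defensive.

Import GRing.Theory.
Local Open Scope ring_scope.

(** * Polynomial functions of an infinite array *)

Section PolynomialFunctions.

Variable k : closedFieldType.

(** Matrices are continued by arbitrary entries outside of their index range,
    so that indices carry no bounds; a condition on the support takes the
    place of the size. *)
Definition array := nat -> nat -> k.

Implicit Types (P Q R : array -> k) (X : array).

(** A closure predicate instead of the image of a polynomial ring:
    substitution and division by a coordinate then go by structural induction.
    *)
Inductive polyfun : (array -> k) -> Prop :=
| polyfun_const c : polyfun (fun _ => c)
| polyfun_entry i j : polyfun (fun X => X i j)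
| polyfun_add P Q : polyfun P -> polyfun Q -> polyfun (fun X => P X + Q X)
| polyfun_mul P Q : polyfun P -> polyfun Q -> polyfun (fun X => P X * Q X).

Lemma polyfun_ext P Q : P =1 Q -> polyfun P -> polyfun Q.
Proof. by move=> /funext ->. Qed.

Lemma polyfun_sub P Q :
  polyfun P -> polyfun Q -> polyfun (fun X => P X - Q X).
Proof.
move=> pP pQ; apply: (@polyfun_ext (fun X => P X + -1 * Q X)).
  by move=> X; rewrite mulN1r.
by apply: polyfun_add => //; apply: polyfun_mul => //; apply: polyfun_const.
Qed.

Lemma polyfun_sum (I : Type) (s : seq I) (F : I -> array -> k) :
  (forall i, polyfun (F i)) -> polyfun (fun X => \sum_(i <- s) F i X).
Proof.
move=> pF; elim: s => [|i s IHs].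
  by apply: polyfun_ext (polyfun_const 0) => X; rewrite big_nil.
apply: polyfun_ext (polyfun_add (pF i) IHs) => X; by rewrite big_cons.
Qed.

Lemma polyfun_prod (I : Type) (s : seq I) (F : I -> array -> k) :
  (forall i, polyfun (F i)) -> polyfun (fun X => \prod_(i <- s) F i X).
Proof.
move=> pF; elim: s => [|i s IHs].
  by apply: polyfun_ext (polyfun_const 1) => X; rewrite big_nil.
apply: polyfun_ext (polyfun_mul (pF i) IHs) => X; by rewrite big_cons.
Qed.

Lemma polyfun_exp P m : polyfun P -> polyfun (fun X => P X ^+ m).
Proof.
move=> pP; elim: m => [|m IHm].
  by apply: polyfun_ext (polyfun_const 1) => X; rewrite expr0.
by apply: polyfun_ext (polyfun_mul pP IHm) => X; rewrite exprS.
Qed.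

Lemma polyfun_det n (M : array -> 'M[k]_n) :
  (forall i j, polyfun (fun X => M X i j)) -> polyfun (fun X => \det (M X)).
Proof.
move=> pM; apply: polyfun_sum => s; apply: polyfun_mul.
  exact: polyfun_const.
exact: polyfun_prod.
Qed.

Lemma polyfun_comp P (Y : array -> array) :
  polyfun P -> (forall i j, polyfun (fun X => Y X i j)) ->
  polyfun (fun X => P (Y X)).
Proof.
move=> pP pY; elim: pP => {P} [c|i j|P Q _ IP _ IQ|P Q _ IP _ IQ] //.
- exact: polyfun_const.
- exact: polyfun_add.
- exact: polyfun_mul.
Qed.

(** Restriction to a polynomial curve: this reduces identities between
    polynomial functions to the fact that a univariate polynomial over an
    infinite field is determined by its values. *)
Lemma polyfun_curve P (Y : nat -> nat -> {poly k}) :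
  polyfun P -> exists h, forall c, h.[c] = P (fun i j => (Y i j).[c]).
Proof.
elim=> {P} [c|i j|P Q _ [h hE] _ [g gE]|P Q _ [h hE] _ [g gE]].
- by exists c%:P => x; rewrite hornerC.
- by exists (Y i j).
- by exists (h + g) => c; rewrite hornerD hE gE.
- by exists (h * g) => c; rewrite hornerM hE gE.
Qed.

Lemma poly_eq0_horner (h : {poly k}) : (forall c, h.[c] = 0) -> h = 0.
Proof.
move=> h0; apply/eqP; apply: contraT => /closed_nonrootP [x].
by rewrite /root h0 eqxx.
Qed.

Lemma poly_eq0_generic (g h : {poly k}) :
  g != 0 -> (forall c, g.[c] != 0 -> h.[c] = 0) -> h = 0.
Proof.
move=> g_nz h0; apply/eqP; apply: contraT => h_nz.
suff: g * h = 0 by move/eqP; rewrite mulf_eq0 (negPf g_nz) (negPf h_nz).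
apply: poly_eq0_horner => c; rewrite hornerM.
by have [->|/h0 ->] := eqVneq g.[c] 0; rewrite ?mul0r ?mulr0.
Qed.

Lemma poly_eq0_punctured (h : {poly k}) :
  (forall c, c != 0 -> h.[c] = 0) -> h = 0.
Proof.
by move=> h0; apply: (@poly_eq0_generic 'X) => [|c]; rewrite ?polyX_eq0 ?hornerX //; apply: h0.
Qed.

Definition upd X a q z : array :=
  fun i j => if (i == a) && (j == q) then z else X i j.

Lemma upd_same X a q z : upd X a q z a q = z.
Proof. by rewrite /upd !eqxx. Qed.

Lemma upd_id X a q : upd X a q (X a q) = X.
Proof.
apply/funext => i; apply/funext => j; rewrite /upd.
by case: ifP => // /andP [/eqP -> /eqP ->].
Qed.

Lemma polyfun_upd P a q c : polyfun P -> polyfun (fun X => P (upd X a q c)).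
Proof.
move=> pP; apply: (polyfun_comp (Y := fun X => upd X a q c)) => // i j; rewrite /upd.
by case: ((i == a) && (j == q)); [apply: polyfun_const|apply: polyfun_entry].
Qed.

(** A polynomial function that vanishes on a coordinate hyperplane is
    divisible by the coordinate. *)
Lemma polyfun_split P a q : polyfun P ->
  exists2 R, polyfun R & forall X, P X = P (upd X a q 0) + X a q * R X.
Proof.
elim=> {P} [c|i j|P Q pP [R pR RE] pQ [S pS SE]|P Q pP [R pR RE] pQ [S pS SE]].
- exists (fun _ => 0); first exact: polyfun_const.
  by move=> X; rewrite mulr0 addr0.
- exists (fun _ => ((i == a) && (j == q))%:R); first exact: polyfun_const.
  move=> X; rewrite /upd; case: ifP => [/andP [/eqP -> /eqP ->]|_].
    by rewrite add0r mulr1.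
  by rewrite mulr0 addr0.
- exists (fun X => R X + S X); first exact: polyfun_add.
  by move=> X; rewrite (RE X) (SE X); ring.
- exists (fun X => R X * Q (upd X a q 0) + P X * S X).
    by apply: polyfun_add; apply: polyfun_mul => //; apply: polyfun_upd.
  by move=> X; rewrite (RE X) (SE X); ring.
Qed.

(** Off the hyperplane [X a q = 0] is enough, since a line that leaves the
    hyperplane meets it only once. *)
Lemma polyfun_eq_generic P Q a q X : polyfun P -> polyfun Q ->
  (forall z, z != 0 -> P (upd X a q z) = Q (upd X a q z)) -> P X = Q X.
Proof.
move=> pP pQ PQ; pose Y i j : {poly k} := if (i == a) && (j == q) then 'X else (X i j)%:P.
have YE c : (fun i j => (Y i j).[c]) = upd X a q c.
  apply/funext => i; apply/funext => j; rewrite /Y /upd.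
  by case: ifP; rewrite ?hornerX ?hornerC.
have [h hE] := polyfun_curve Y (polyfun_sub pP pQ).
have h0 : h = 0.
  by apply: poly_eq0_punctured => c c_nz; rewrite hE YE PQ // subrr.
have := hE (X a q); rewrite h0 horner0 YE upd_id => /esym /eqP.
by rewrite subr_eq0 => /eqP.
Qed.

End PolynomialFunctions.

(** * Bideterminants *)

Section Bideterminants.

Variable k : closedFieldType.
Variable p : nat.

Implicit Types (lam : nat -> nat) (T : nat -> nat -> nat) (X : array k).

(** Shapes are functions here because the inductions below change one part at
    a time. *)
Definition is_shape lam : Prop :=
  (forall i, (lam i.+1 <= lam i)%N) /\ (forall i, (p <= i)%N -> lam i = 0%N).

(** The conjugate partition. *)
Definition col_len lam j := find (fun i => lam i <= j)%N (iota 0 p).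

Lemma shape_le lam i i' : is_shape lam -> (i <= i')%N -> (lam i' <= lam i)%N.
Proof.
move=> [dec _] /subnK <-; elim: (i' - i)%N => // d IHd.
by rewrite addSn; apply: leq_trans (dec _) IHd.
Qed.

Lemma col_len_le lam j : (col_len lam j <= p)%N.
Proof. by rewrite -[leqRHS](size_iota 0); apply: find_size. Qed.

Lemma ltn_col_len lam i j : is_shape lam -> (i < col_len lam j)%N = (j < lam i)%N.
Proof.
move=> part; have [_ lam0] := part.
have len_p := col_len_le lam j.
case: ltnP => [lt_i|le_i].
  have lt_ip := leq_trans lt_i len_p.
  have := before_find 0%N lt_i; rewrite nth_iota // add0n => /negbT.
  by rewrite -ltnNge.
apply/esym/negbTE; rewrite -leqNgt.
apply: leq_trans (shape_le part le_i) _.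
have [lt_p|le_p] := ltnP (col_len lam j) p; last by rewrite lam0.
have h : has (fun i0 => lam i0 <= j)%N (iota 0 p) by rewrite has_find size_iota.
by have := nth_find 0%N h; rewrite -/(col_len lam j) nth_iota.
Qed.

Lemma col_len_eq lam j l : is_shape lam ->
  (forall i, (i < l)%N = (j < lam i)%N) -> col_len lam j = l.
Proof.
move=> part lP; apply/eqP; rewrite eqn_leq.
have := ltn_col_len l j part; rewrite -lP ltnn => /negbT; rewrite -leqNgt => ->.
by have := lP (col_len lam j); rewrite -ltn_col_len // ltnn => /negbT; rewrite -leqNgt.
Qed.

Lemma col_len_ge lam j : is_shape lam -> (lam 0 <= j)%N -> col_len lam j = 0%N.
Proof.
move=> part le_j; apply: col_len_eq => // i; apply/esym/negbTE.
by rewrite -leqNgt (leq_trans (shape_le part (leq0n i))).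
Qed.

Definition minor l (t : nat -> nat) X : k := \det (\matrix_(a < l, b < l) X a (t b)).

(** The highest weight vector of the row action that belongs to a tableau, as
    a product of minors on initial rows, one for each column. *)
Definition bidet lam T X : k :=
  \prod_(j < lam 0%N) minor (col_len lam j) (T^~ j) X.

Lemma minor0 t X : minor 0 t X = 1.
Proof. by rewrite /minor det_mx00. Qed.

Lemma minor_eq l t t' X X' :
  (forall a b, (a < l)%N -> (b < l)%N -> X a (t b) = X' a (t' b)) ->
  minor l t X = minor l t' X'.
Proof. by move=> eqX; congr (\det _); apply/matrixP => a b; rewrite !mxE eqX. Qed.

Lemma bidet_eq lam T T' X X' : is_shape lam ->
  (forall i i' j, (j < lam i)%N -> (j < lam i')%N -> X i (T i' j) = X' i (T' i' j)) ->
  bidet lam T X = bidet lam T' X'.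
Proof.
move=> part eqX; apply: eq_bigr => j _; apply: minor_eq => a b.
by rewrite !ltn_col_len //; apply: eqX.
Qed.

Lemma bidet_widen N lam T X : is_shape lam -> (lam 0 <= N)%N ->
  bidet lam T X = \prod_(j < N) minor (col_len lam j) (T^~ j) X.
Proof.
move=> part leN; rewrite /bidet (big_ord_widen N (fun j => minor (col_len lam j) (T^~ j) X)) //.
rewrite big_mkcond; apply: eq_bigr => j _; case: ltnP => // le_j.
by rewrite col_len_ge // minor0.
Qed.

Lemma polyfun_minor l t : polyfun (minor l t).
Proof.
apply: polyfun_det => a b.
by apply: polyfun_ext (polyfun_entry _ _ _) => X; rewrite mxE.
Qed.

Lemma polyfun_bidet lam T : polyfun (bidet lam T).
Proof. by apply: polyfun_prod => j; apply: polyfun_minor. Qed.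

Definition rowadd i (c : k) X : array k :=
  fun i' j => X i' j + (if i' == i.+1 then c * X i j else 0).

Definition rowscale i (t : k) X : array k :=
  fun i' j => if i' == i then t * X i' j else X i' j.

(** Either both rows belong to the minor, and this is a row operation on a
    determinant, or the row that changes does not belong to it. *)
Lemma minor_rowadd l t i c X : minor l t (rowadd i c X) = minor l t X.
Proof.
have [lt_l|ge_l] := ltnP i.+1 l; last first.
  apply: minor_eq => a b lt_a _; rewrite /rowadd ifN ?addr0 //.
  by apply: contraTneq lt_a => ->; rewrite -leqNgt.
pose i1 := Ordinal lt_l; pose i0 := Ordinal (ltnW lt_l).
pose A := \matrix_(a < l, b < l) X a (t b).
pose B := \matrix_(a < l, b < l) (if a == i1 then A i0 b else A a b).
rewrite /minor (@determinant_multilinear _ _ _ A B i1 1 c).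
- rewrite mul1r (determinant_alternate (A := B) (i1 := i1) (i2 := i0)) ?mulr0 ?addr0 //.
    by rewrite -val_eqE /= gtn_eqF.
  by move=> b; rewrite !mxE eqxx -val_eqE /= ltn_eqF.
- by apply/rowP => b; rewrite !mxE /rowadd !eqxx /= mul1r.
- apply/matrixP => a b; rewrite !mxE /rowadd /= -[bump _ _]/(val (lift i1 a)).
  by rewrite -[i.+1]/(val i1) val_eqE eq_sym (negPf (neq_lift _ _)) addr0.
- apply/matrixP => a b; rewrite !mxE /rowadd /= eq_sym (negPf (neq_lift _ _)).
  rewrite -[bump _ _]/(val (lift i1 a)) -[i.+1]/(val i1) val_eqE eq_sym.
  by rewrite (negPf (neq_lift _ _)) addr0.
Qed.

Lemma bidet_rowadd lam T i c X : bidet lam T (rowadd i c X) = bidet lam T X.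
Proof. by apply: eq_bigr => j _; rewrite minor_rowadd. Qed.

Lemma minor_rowscale l t i c X :
  minor l t (rowscale i c X) = c ^+ (i < l)%N * minor l t X.
Proof.
pose d : 'rV[k]_l := \row_a (if a == i :> nat then c else 1).
have -> : minor l t (rowscale i c X) = \det (diag_mx d *m \matrix_(a < l, b < l) X a (t b)).
  congr (\det _); apply/matrixP => a b; rewrite mul_diag_mx !mxE /rowscale.
  by case: ifP; rewrite ?mul1r.
rewrite det_mulmx det_diag; congr (_ * _).
have [lt_l|ge_l] := ltnP i l.
  rewrite (bigD1 (Ordinal lt_l)) //= mxE eqxx big1 ?mulr1 // => a ne_a.
  by rewrite mxE ifN.
rewrite big1 // => a _; rewrite mxE ifN //.
by apply: contraTneq ge_l => <-; rewrite -ltnNge.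
Qed.

Lemma sum_col_len lam i : is_shape lam ->
  (\sum_(j < lam 0%N) (i < col_len lam j) = lam i)%N.
Proof.
move=> part.
rewrite (eq_bigr (fun j : 'I_(lam 0%N) => nat_of_bool (j < lam i)%N)); last first.
  by move=> j _; rewrite ltn_col_len.
rewrite -(big_mkord xpredT (fun j => nat_of_bool (j < lam i)%N)).
rewrite (big_cat_nat (n := lam i)) //= ?shape_le //.
have -> : (\sum_(lam i <= j < lam 0) (j < lam i) = 0)%N.
  by rewrite big_nat_cond big1 // => j /andP [/andP [le_j _] _]; rewrite ltnNge le_j.
rewrite addn0 (@eq_big_nat _ _ _ _ _ _ (fun=> 1%N)) => [|j /andP [_ ->]] //.
by rewrite sum_nat_const_nat subn0 muln1.
Qed.

Lemma bidet_rowscale lam T i c X : is_shape lam ->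
  bidet lam T (rowscale i c X) = c ^+ lam i * bidet lam T X.
Proof.
move=> part; rewrite /bidet (eq_bigr _ (fun _ _ => minor_rowscale _ _ _ _ _)).
by rewrite big_split /= prodrXr sum_col_len.
Qed.

Lemma minor_last l t X : (forall a, (a < l)%N -> X a (t l) = 0) ->
  minor l.+1 t X = X l (t l) * minor l t X.
Proof.
move=> X0; rewrite /minor (expand_det_col _ ord_max) (bigD1 ord_max) //=.
rewrite big1 ?addr0 => [|a ne_a]; last first.
  rewrite mxE X0 ?mul0r //= ltn_neqAle -ltnS ltn_ord andbT.
  by apply: contra ne_a => /eqP e; apply/eqP/val_inj.
rewrite mxE /cofactor /= -signr_odd addnn odd_double expr0 mul1r; congr (_ * \det _).
apply/matrixP => a b; rewrite !mxE /= /bump.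
by rewrite ![(l <= _)%N]leqNgt !ltn_ord.
Qed.

Definition drop_box a lam : nat -> nat := fun i => if i == a then (lam i).-1 else lam i.

(** The last box of row [a] is the end of a column, and of the entries of
    column [q] that the corresponding minor uses only [X a q] is nonzero; so
    expansion along that column leaves the minor without its last row and
    column. *)
Lemma bidet_drop_box lam T a q X :
  is_shape lam -> is_shape (drop_box a lam) -> (0 < lam a)%N ->
  T a (lam a).-1 = q -> (forall i, (i < a)%N -> X i q = 0) ->
  bidet lam T X = X a q * bidet (drop_box a lam) T X.
Proof.
move=> part part' pos Tq X0.
have le0 : (drop_box a lam 0 <= lam 0)%N.
  by rewrite /drop_box; case: ifP => // _; apply: leq_pred.
rewrite (bidet_widen T X part' le0) /bidet.
have lt_j0 : ((lam a).-1 < lam 0)%N.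
  by rewrite prednK // (shape_le part).
pose j0 := Ordinal lt_j0.
rewrite (bigD1 j0) //= [X in _ = _ * X](bigD1 j0) //= mulrA; congr (_ * _).
  have -> : col_len lam (lam a).-1 = a.+1.
    apply: col_len_eq => // i; rewrite ltnS.
    have [le_i|gt_i] := leqP i a; first by rewrite prednK // (shape_le part).
    have := part'.1 a; rewrite /drop_box eqxx gtn_eqF // => le1.
    by apply/esym/negbTE; rewrite -leqNgt (leq_trans (shape_le part gt_i)).
  have -> : col_len (drop_box a lam) (lam a).-1 = a.
    apply: col_len_eq => // i; rewrite /drop_box; case: eqP => [->|/eqP ne_i].
      by rewrite !ltnn.
    have [lt_i|ge_i] := ltnP i a; first by rewrite prednK // (shape_le part) // ltnW.
    have gt_i : (a < i)%N by rewrite ltn_neqAle eq_sym ne_i.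
    have := part'.1 a; rewrite /drop_box eqxx gtn_eqF // => le1.
    by apply/esym/negbTE; rewrite -leqNgt (leq_trans (shape_le part gt_i)).
  by rewrite minor_last Tq.
apply: eq_bigr => j ne_j; congr minor; apply: col_len_eq => // i.
rewrite ltn_col_len // /drop_box; case: eqP => // ->.
rewrite -{2}(prednK pos) ltnS [RHS]leq_eqVlt.
by have /negPf -> : val j != (lam a).-1.
Qed.

End Bideterminants.

(** * Semi-invariants of the unipotent group acting on rows *)

Section RowSemiInvariants.

Variable k : closedFieldType.
Variable p : nat.

Implicit Types (lam : nat -> nat) (T : nat -> nat -> nat) (X : array k).
Implicit Types (P Q R : array k -> k) (q b : nat).

(** The entries of a matrix with [p] rows become available one after the
    other: the columns in increasing order, each of them from the bottom row
    upwards. At stage [(q, b)] these are the columns before [q] and the last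
    [b] rows of column [q]. In a tableau the same condition says which value
    may occur in which row. *)
Definition allowed q b i j := (i < p)%N && ((j < q)%N || (j == q) && (p <= i + b)%N).

Definition supp q b X := forall i j, ~~ allowed q b i j -> X i j = 0.

Definition sstab q b lam T :=
  [/\ forall i j, (j < lam i)%N -> allowed q b i (T i j),
      forall i j, (j.+1 < lam i)%N -> (T i j <= T i j.+1)%N &
      forall i j, (j < lam i.+1)%N -> (T i j < T i.+1 j)%N].

(** The unipotent row operations add a multiple of a row to the next one, so
    they preserve the support of every stage; invariance and weight are
    required on that support only. *)
Definition row_semi q b lam P :=
  [/\ polyfun P,
      forall i c X, (i.+1 < p)%N -> supp q b X -> P (rowadd i c X) = P X &
      forall i t X, (i < p)%N -> t != 0 -> supp q b X ->
        P (rowscale i t X) = t ^+ lam i * P X].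

Lemma allowedS q b i j : allowed q b i j -> allowed q b.+1 i j.
Proof.
rewrite /allowed => /andP [-> /orP [->|/andP [-> ?]]] //=.
by rewrite addnS leqW // orbT.
Qed.

Lemma supp_widen q b X : supp q b X -> supp q b.+1 X.
Proof. by move=> sX i j /(contra (@allowedS _ _ _ _)); apply: sX. Qed.

Lemma allowed_down q b i j : (i.+1 < p)%N -> allowed q b i j -> allowed q b i.+1 j.
Proof.
rewrite /allowed => -> /andP [_ /orP [->|/andP [-> ?]]] //=.
by rewrite addSn leqW // orbT.
Qed.

Lemma supp_rowadd q b i c X : (i.+1 < p)%N -> supp q b X -> supp q b (rowadd i c X).
Proof.
move=> lt_i sX i' j nal; rewrite /rowadd (sX i' j) // add0r.
case: eqP => // ei; rewrite sX ?mulr0 //; apply: contra nal; rewrite ei.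
exact: allowed_down.
Qed.

Lemma supp_rowscale q b i c X : supp q b X -> supp q b (rowscale i c X).
Proof. by move=> sX i' j nal; rewrite /rowscale sX // mulr0 if_same. Qed.

Lemma row_semi_widen q b lam P : row_semi q b.+1 lam P -> row_semi q b lam P.
Proof.
case=> pP Padd Psc; split=> // [i c X lt_i|i t X lt_i t_nz] /supp_widen sX.
  exact: Padd.
exact: Psc.
Qed.

Lemma row_semi_lin q b lam c P Q :
  row_semi q b lam P -> row_semi q b lam Q -> row_semi q b lam (fun X => c * P X + Q X).
Proof.
case=> pP Padd Psc [pQ Qadd Qsc]; split=> [|i d X lt_i sX|i t X lt_i t_nz sX].
- by apply: polyfun_add => //; apply: polyfun_mul => //; apply: polyfun_const.
- by rewrite Padd ?Qadd.
- by rewrite Psc ?Qsc //; ring.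
Qed.

Lemma row_semi_bidet q b lam T : is_shape p lam -> row_semi q b lam (bidet p lam T).
Proof.
move=> part; split=> [|i c X _ _|i t X _ _ _].
- exact: polyfun_bidet.
- exact: bidet_rowadd.
- exact: bidet_rowscale.
Qed.

(** In SL2 one has
      [1 c; 0 1] = [1 0; 1/c 1] diag(c, 1/c) [0 1; -1 0] [1 0; 1/c 1].
    So a function that is fixed by the lower unipotents takes along the orbit
    of [X] under the upper unipotents values that are polynomial in [c], and up
    to the power of [c] which the weight prescribes also polynomial in [1/c].
    If the weight is not dominant, no nonzero function has both properties. *)
Lemma row_semi_dominant q b lam P a :
  (a.+1 < p)%N -> (forall j, allowed q b a.+1 j -> allowed q b a j) ->
  row_semi q b lam P -> (lam a < lam a.+1)%N -> forall X, supp q b X -> P X = 0.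
Proof.
move=> lt_a alE [pP Padd Psc] lt_lam X sX.
(* [Y] is the upper unipotent orbit of [X], and [Z] at 1/c is what the two right
   factors of the decomposition make of [X]. *)
pose Y i j : {poly k} := (X i j)%:P + (if i == a then 'X * (X a.+1 j)%:P else 0).
pose Z i j : {poly k} := if i == a then (X a.+1 j)%:P + 'X * (X a j)%:P
  else if i == a.+1 then (- X a j)%:P else (X i j)%:P.
have [h hE] := polyfun_curve Y pP; have [g gE] := polyfun_curve Z pP.
have sZ s : supp q b (fun i j => (Z i j).[s]).
  move=> i j nal; rewrite /Z; case: eqP => [ei|_].
    have Xa : X a j = 0 by rewrite sX // -ei.
    rewrite Xa polyC0 mulr0 addr0 hornerC sX //; apply: contra nal.
    by rewrite ei; apply: alE.
  case: eqP => [ei|_]; last by rewrite hornerC sX.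
  rewrite hornerC sX ?oppr0 //; apply: contra nal; rewrite ei.
  exact: allowed_down.
have key c : c != 0 -> c ^+ (lam a.+1 - lam a) * h.[c] = g.[c^-1].
  move=> c_nz; rewrite hE gE.
  have -> : (fun i j => (Y i j).[c]) =
     rowadd a c^-1 (rowscale a c (rowscale a.+1 c^-1 (fun i j => (Z i j).[c^-1]))).
    apply/funext => i; apply/funext => j; rewrite /rowadd /rowscale /Y /Z.
    have [->|ne_a] := eqVneq i a.
      by rewrite ltn_eqF // hornerD !hornerE /=; field.
    have [->|ne_a1] := eqVneq i a.+1; last by rewrite !hornerE /=.
    by rewrite eqxx (ltn_eqF (ltnSn a)) !hornerE /=; field.
  have lt_a' := ltnW lt_a; have ci_nz := c_nz; rewrite -invr_eq0 in ci_nz.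
  have s1 := sZ c^-1.
  have s2 := supp_rowscale a.+1 c^-1 s1.
  have s3 := supp_rowscale a c s2.
  rewrite Padd // Psc // Psc // !mulrA -exprD subnK ?(ltnW lt_lam) // -exprMn.
  by rewrite mulfV // expr1n mul1r.
set d := (lam a.+1 - lam a)%N in key; set N := size g.
(* c ^ N g(1/c) as a polynomial in [c]; its degree is at most [N]. *)
pose g' := \poly_(i < N.+1) g`_(N - i).
have eq_hg : h * 'X^(d + N) = g'.
  apply/eqP; rewrite -subr_eq0; apply/eqP; apply: poly_eq0_punctured => c c_nz.
  rewrite hornerD hornerN hornerM hornerXn exprD mulrA [h.[c] * _]mulrC key //.
  rewrite horner_poly (@horner_coef_wide _ N.+1) ?leqnSn // (reindex_inj rev_ord_inj).
  rewrite mulr_suml; apply/eqP; rewrite subr_eq0; apply/eqP; apply: eq_bigr => i _ /=.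
  rewrite subSS -mulrA; congr (_ * _); rewrite exprVn mulrC.
  by rewrite -{1}(subnKC (ltn_ord i : i <= N)%N) exprD mulfK // expf_neq0.
have [h0|h_nz] := eqVneq h 0.
  have := hE 0; rewrite h0 horner0 => ->; congr P.
  by apply/funext => i; apply/funext => j; rewrite /Y; case: ifP; rewrite !hornerE ?mul0r ?addr0.
have := size_poly N.+1 (fun i => g`_(N - i)); rewrite -/g' -eq_hg.
rewrite size_mulXn // => le_N.
have : (0 < size h)%N by rewrite size_poly_gt0.
have : (0 < d)%N by rewrite subn_gt0.
by lia.
Qed.

Lemma sstab_le_row q b lam T i j j' : sstab q b lam T -> (j <= j')%N -> (j' < lam i)%N ->
  (T i j <= T i j')%N.
Proof.
move=> [_ Trow _] /subnKC <-; elim: (j' - j)%N => [|d IHd]; first by rewrite addn0.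
by rewrite addnS => lt_d; apply: leq_trans (IHd (ltnW lt_d)) (Trow _ _ lt_d).
Qed.

(** ** One-step restriction of the support *)

Section Step.

Variables (q b a : nat).
Hypothesis abE : (a + b.+1 = p)%N.

Let lt_ap : (a < p)%N. Proof. by rewrite -abE; lia. Qed.

Lemma allowed_corner : allowed q b.+1 a q.
Proof. by rewrite /allowed lt_ap eqxx abE leqnn orbT. Qed.

Lemma allowed_above i j : (i < a)%N -> allowed q b.+1 i j -> (j < q)%N.
Proof.
move=> lt_i; rewrite /allowed => /andP [_ /orP [//|/andP [_ le_p]]].
by move: le_p; rewrite -abE leq_add2r leqNgt lt_i.
Qed.

Lemma supp_above X i : supp q b.+1 X -> (i < a)%N -> X i q = 0.
Proof.
by move=> sX lt_i; apply: sX; apply/negP => /(allowed_above lt_i); rewrite ltnn.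
Qed.

Lemma allowed_pred i j : allowed q b.+1 i j ->
  ~~ ((i == a) && (j == q)) -> allowed q b i j.
Proof.
rewrite /allowed => /andP [-> /orP [->|/andP [/eqP -> ]]] //=.
rewrite eqxx andbT orbC /= => le1 ne; apply/orP; left.
by move: le1 ne; rewrite -abE; lia.
Qed.

Lemma supp_upd X z : supp q b.+1 X -> supp q b.+1 (upd X a q z).
Proof.
move=> sX i j nal; rewrite /upd; case: ifP => [/andP [/eqP ei /eqP ej]|_].
  by rewrite ei ej allowed_corner in nal.
exact: sX.
Qed.

Lemma supp_pred X : supp q b.+1 X -> X a q = 0 -> supp q b X.
Proof.
move=> sX X0 i j nal; have [/andP [/eqP -> /eqP ->] //|ne] := boolP ((i == a) && (j == q)).
by apply: sX; apply: contra nal => /allowed_pred; apply.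
Qed.

Lemma polyfun_eq_generic_supp P Q : polyfun P -> polyfun Q ->
  (forall X, supp q b.+1 X -> X a q != 0 -> P X = Q X) ->
  forall X, supp q b.+1 X -> P X = Q X.
Proof.
move=> pP pQ PQ X sX; apply: (@polyfun_eq_generic _ _ _ a q) => // z z_nz.
by apply: PQ; rewrite ?upd_same //; apply: supp_upd.
Qed.

Lemma supp_corner X : supp q b X -> X a q = 0.
Proof.
by move=> sX; apply: sX; rewrite /allowed lt_ap ltnn eqxx /= -abE addnS ltnn.
Qed.

(** If row [a] has weight 0, scaling it by 0 does not change the value, and
    puts the corner entry to 0. *)
Lemma row_semi_vanish lam P : row_semi q b.+1 lam P -> lam a = 0%N ->
  (forall X, supp q b X -> P X = 0) -> forall X, supp q b.+1 X -> P X = 0.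
Proof.
move=> [pP _ Psc] lam0 P0 X sX.
pose Y i j : {poly k} := if i == a then 'X * (X i j)%:P else (X i j)%:P.
have YE c : (fun i j => (Y i j).[c]) = rowscale a c X.
  apply/funext => i; apply/funext => j; rewrite /Y /rowscale.
  by case: ifP; rewrite !hornerE.
have [h hE] := polyfun_curve Y pP.
have h_cst : h - (P X)%:P = 0.
  apply: poly_eq0_punctured => c c_nz.
  by rewrite hornerD hornerN hornerC hE YE Psc // lam0 expr0 mul1r subrr.
have := hE 0; move/subr0_eq: h_cst => ->; rewrite hornerC => ->.
apply: P0; rewrite YE; apply: supp_pred; first exact: supp_rowscale.
by rewrite /rowscale eqxx mul0r.
Qed.

(** On the support of the stage the corner entry [y = X a q] is itself a
    semi-invariant, whose weight is the [a]-th unit vector: no row operation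
    reaches it, as the entries above it vanish. So the quotient by [y] of a
    semi-invariant that vanishes with [y] is a semi-invariant. *)
Lemma row_semi_divide lam P : row_semi q b.+1 lam P -> (0 < lam a)%N ->
  (forall X, supp q b X -> P X = 0) ->
  exists2 R, row_semi q b.+1 (drop_box a lam) R &
    forall X, supp q b.+1 X -> P X = X a q * R X.
Proof.
move=> [pP Padd Psc] pos P0; have [R pR RE] := polyfun_split a q pP.
have {}RE X : supp q b.+1 X -> P X = X a q * R X.
  move=> sX; rewrite {1}RE P0 ?add0r //; apply: supp_pred; last exact: upd_same.
  exact: supp_upd.
exists R => //; split=> // [i c X lt_i|i t X lt_i t_nz].
  apply: (polyfun_eq_generic_supp (P := fun X => R (rowadd i c X)) (Q := R)) => //.
    apply: (polyfun_comp (Y := rowadd i c)) => // i' j.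
    apply: polyfun_add; first exact: polyfun_entry.
    case: (i' == i.+1); last exact: polyfun_const.
    by apply: polyfun_mul; [apply: polyfun_const|apply: polyfun_entry].
  move=> {}X sX X_nz; apply: (mulfI X_nz); rewrite -RE // -(Padd i c) // RE.
    congr (_ * _); rewrite /rowadd; case: eqP => [ea|_]; last by rewrite addr0.
    by rewrite (supp_above sX (i := i)) ?ea ?mulr0 ?addr0 // ea.
  exact: supp_rowadd.
apply: (polyfun_eq_generic_supp (P := fun X => R (rowscale i t X))
  (Q := fun X => t ^+ drop_box a lam i * R X)).
- apply: (polyfun_comp (Y := rowscale i t)) => // i' j; rewrite /rowscale.
  case: (i' == i); last exact: polyfun_entry.
  by apply: polyfun_mul; [apply: polyfun_const|apply: polyfun_entry].
- by apply: polyfun_mul => //; apply: polyfun_const.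
move=> {}X sX X_nz; apply: (mulfI X_nz).
have := Psc i t X lt_i t_nz sX; rewrite !RE //; last exact: supp_rowscale.
rewrite /rowscale /drop_box eq_sym; case: eqP => [->|_] E; last first.
  by rewrite E mulrCA.
apply: (mulfI t_nz); rewrite mulrA E -{1}(prednK pos) exprS; ring.
Qed.

(** The value [q] is the largest, and above row [a] it is not allowed; so it
    may be put at the end of row [a] whenever this gives a shape. *)
Lemma sstab_add_box lam T : is_shape p lam -> is_shape p (drop_box a lam) -> (0 < lam a)%N ->
  sstab q b.+1 (drop_box a lam) T ->
  sstab q b.+1 lam (fun i j => if (i == a) && (j == (lam a).-1) then q else T i j).
Proof.
move=> part part' pos [Tal Trow Tcol].
have below j : (j < lam a.+1)%N -> (j < (lam a).-1)%N.
  by have := part'.1 a; rewrite /drop_box eqxx gtn_eqF // => le1 /leq_trans; apply.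
have old i j : (j < lam i)%N -> (i == a) && (j == (lam a).-1) = false ->
    (j < drop_box a lam i)%N.
  by rewrite /drop_box; case: eqP => [->|] //=; lia.
split=> i j lt_j.
- case: ifP => [/andP [/eqP -> _]|ne]; first exact: allowed_corner.
  by apply: Tal; apply: old.
- have ne : (i == a) && (j == (lam a).-1) = false.
    by apply/negbTE; apply: contraL lt_j => /andP [/eqP -> /eqP ->]; rewrite prednK // ltnn.
  rewrite ne; case: ifP => [/andP [/eqP ei _]|ne']; last by apply: Trow; apply: old.
  have := Tal i j (old _ _ (ltnW lt_j) ne).
  by rewrite /allowed => /andP [_ /orP [/ltnW|/andP [/eqP ->]]].
case: ifP => [/andP [/eqP ei /eqP ej]|ne].
  by have := below j; rewrite -ei => /(_ lt_j); rewrite ei -ej ltnn.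
case: ifP => [/andP [/eqP ei _]|ne']; last by apply: Tcol; apply: old.
have lt_i : (i < a)%N by rewrite -ei.
apply: (allowed_above lt_i); apply: Tal; apply: old => //.
exact: leq_trans lt_j (part.1 i).
Qed.

(** Rows increase and [q] is the largest value, so row [a] contains [q] only
    if it ends with [q]. *)
Lemma sstab_no_corner lam T : sstab q b.+1 lam T ->
  ~~ ((0 < lam a)%N && (T a (lam a).-1 == q)) -> sstab q b lam T.
Proof.
move=> ssT nq; have [Tal Trow Tcol] := ssT; split=> // i j lt_j.
apply: allowed_pred; first exact: Tal.
apply: contra nq => /andP [/eqP ei /eqP ej]; rewrite -ei.
have pos : (0 < lam i)%N by apply: leq_ltn_trans lt_j.
rewrite pos andTb eqn_leq -{2}ej; apply/andP; split; last first.
  by apply: (sstab_le_row ssT); [rewrite -ltnS|]; rewrite prednK.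
have := Tal i (lam i).-1; rewrite prednK // => /(_ (leqnn _)).
by rewrite /allowed => /andP [_ /orP [/ltnW|/andP [/eqP ->]]].
Qed.

Lemma sstab_drop_box lam T : sstab q b.+1 lam T -> sstab q b.+1 (drop_box a lam) T.
Proof.
have le i j : (j < drop_box a lam i)%N -> (j < lam i)%N.
  by rewrite /drop_box; case: eqP => // _ /leq_trans; apply; apply: leq_pred.
by case=> Tal Trow Tcol; split=> i j /le; [apply: Tal|apply: Trow|apply: Tcol].
Qed.

Lemma shape_drop_box lam : is_shape p lam ->
  (lam a.+1 <= (lam a).-1)%N -> is_shape p (drop_box a lam).
Proof.
move=> [dec lam0] le_a; split=> i.
  rewrite /drop_box; case: (eqVneq i a) => [->|ne_i]; first by rewrite gtn_eqF.
  by case: (i.+1 == a); [apply: leq_trans (leq_pred _) _|]; apply: dec.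
by move=> /lam0; rewrite /drop_box; case: eqP => // _ ->.
Qed.

(** Below a box with the largest value there is no box. *)
Lemma sstab_corner_shape lam T : is_shape p lam -> sstab q b.+1 lam T -> (0 < lam a)%N ->
  T a (lam a).-1 = q -> is_shape p (drop_box a lam).
Proof.
move=> part [Tal _ Tcol] pos Tq; apply: shape_drop_box => //.
rewrite leqNgt; apply/negP => lt_a.
have := Tcol a (lam a).-1 lt_a; rewrite Tq.
have := Tal _ _ lt_a; rewrite /allowed => /andP [_ /orP [|/andP [/eqP -> _]]]; lia.
Qed.

End Step.

Lemma allowed_wrap q i j : allowed q.+1 0 i j = allowed q p i j.
Proof.
rewrite /allowed ltnS addn0 leq_addl andbT [X in (_ || _ && X)]leqNgt.
by case: (i < p)%N; rewrite //= andbF orbF leq_eqVlt orbC.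
Qed.

Lemma supp_wrap q X : supp q.+1 0 X <-> supp q p X.
Proof. by split=> sX i j nal; apply: sX; move: nal; rewrite allowed_wrap. Qed.

Lemma sstab_wrap q lam T : sstab q.+1 0 lam T <-> sstab q p lam T.
Proof.
by split=> -[Tal Trow Tcol]; split=> // i j /Tal; rewrite allowed_wrap.
Qed.

(** ** Bideterminants span the semi-invariants *)

(** The inductive form keeps track of linear combinations of bideterminants
    without naming a finite family of tableaux. *)
Inductive bispan q b lam : (array k -> k) -> Prop :=
| bispan_zero P : (forall X, supp q b X -> P X = 0) -> bispan q b lam P
| bispan_cons c T P R : sstab q b lam T -> bispan q b lam P ->
    (forall X, supp q b X -> R X = c * bidet p lam T X + P X) -> bispan q b lam R.

Lemma bispan_ext q b lam P R : bispan q b lam P ->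
  (forall X, supp q b X -> R X = P X) -> bispan q b lam R.
Proof.
case=> {P} [P P0|c T P S ssT sP SE] RE.
  by apply: bispan_zero => X sX; rewrite RE ?P0.
by apply: (bispan_cons ssT sP) => X sX; rewrite RE ?SE.
Qed.

Lemma bispan_add q b lam P Q R : bispan q b lam P -> bispan q b lam Q ->
  (forall X, supp q b X -> R X = P X + Q X) -> bispan q b lam R.
Proof.
move=> sP sQ; elim: sP R => {P} [P P0|c T P S ssT sP IH SE] R RE.
  by apply: bispan_ext sQ _ => X sX; rewrite RE ?P0 ?add0r.
apply: (bispan_cons ssT (IH (fun X => P X + Q X) (fun _ _ => erefl _))) => X sX.
by rewrite RE // SE // addrA.
Qed.

Lemma bispan_lift q b lam P : is_shape p lam -> bispan q b lam P ->
  exists2 P', row_semi q b.+1 lam P' /\ bispan q b.+1 lam P' &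
    forall X, supp q b X -> P X = P' X.
Proof.
move=> part; elim=> {P} [P P0|c T P R [Tal Trow Tcol] _ [P' [sP' spP'] PE] RE].
  exists (fun _ => 0) => //; split; last by apply: bispan_zero.
  by split=> [|//|i t X]; rewrite ?mulr0 //; apply: polyfun_const.
exists (fun X => c * bidet p lam T X + P' X); last by move=> X sX; rewrite RE ?PE.
split; first by apply: row_semi_lin => //; apply: row_semi_bidet.
apply: (@bispan_cons _ _ _ c T P') => //; split=> // i j lt_j.
by apply: allowedS; apply: Tal.
Qed.

Lemma bispan_add_box q b a lam R : (a + b.+1 = p)%N ->
  is_shape p lam -> is_shape p (drop_box a lam) -> (0 < lam a)%N ->
  bispan q b.+1 (drop_box a lam) R -> bispan q b.+1 lam (fun X => X a q * R X).
Proof.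
move=> abE part part' pos; elim=> {R} [R R0|c T P R ssT _ IH RE].
  by apply: bispan_zero => X sX; rewrite R0 // mulr0.
apply: (bispan_cons (c := c) (sstab_add_box abE part part' pos ssT) IH) => X sX.
rewrite (@bidet_drop_box _ _ _ _ a q) ?eqxx //; last first.
  by move=> i; apply: (supp_above abE).
rewrite RE // mulrDr mulrCA; congr (_ * (_ * _) + _).
apply: bidet_eq => // i i' j _ lt_j; case: ifP => // /andP [/eqP ei /eqP ej].
by move: lt_j; rewrite /drop_box ei eqxx ej ltnn.
Qed.

(** Let [y] be the new entry. Where [y = 0], the previous stage gives an
    expression by bideterminants; what remains after subtracting them vanishes
    with [y], and its quotient by [y] is a semi-invariant for the shape with
    one box less in row [a], to which induction applies. If this is not a
    shape, the quotient vanishes by dominance. Multiplication by [y] puts the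
    box back, with [q] in it. *)
Lemma row_semi_span_step q b : (b < p)%N ->
  (forall lam P, is_shape p lam -> row_semi q b lam P -> bispan q b lam P) ->
  forall lam P, is_shape p lam -> row_semi q b.+1 lam P -> bispan q b.+1 lam P.
Proof.
move=> lt_b IHb lam P; pose a := (p - b.+1)%N.
have abE : (a + b.+1 = p)%N by rewrite subnK.
move en : (lam a) => n; elim: n lam en P => [|n IHn] lam en P part sP.
  all: have [P' [sP' spP'] PE] := bispan_lift part (IHb lam P part (row_semi_widen sP)).
  all: have sQ := row_semi_lin (-1) sP' sP.
  all: have Q0 X : supp q b X -> -1 * P' X + P X = 0 by move=> sX; rewrite PE // mulN1r addNr.
  apply: bispan_ext spP' _ => X sX.
  by have /eqP := row_semi_vanish abE sQ en Q0 sX; rewrite addrC mulN1r subr_eq0 => /eqP.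
have pos : (0 < lam a)%N by rewrite en.
have [R sR RE] := row_semi_divide abE sQ pos Q0.
have PE' X : supp q b.+1 X -> P X = P' X + X a q * R X.
  by move=> sX; rewrite -RE //; ring.
have [le_a|gt_a] := leqP (lam a.+1) (lam a).-1.
  have part' := shape_drop_box part le_a.
  apply: (bispan_add spP' _ PE'); apply: (bispan_add_box abE) => //.
  by apply: IHn => //; rewrite /drop_box eqxx en.
apply: bispan_ext spP' _ => X sX.
rewrite PE' // (row_semi_dominant (a := a) _ _ sR _ sX) ?mulr0 ?addr0 //.
- rewrite ltnNge; apply/negP => /(part.2) lam0; by rewrite lam0 in gt_a.
- move=> j; rewrite /allowed => /andP [/ltnW -> /orP [->|/andP [-> _]]] //=.
  by rewrite abE leqnn orbT.
- by rewrite /drop_box eqxx gtn_eqF.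
Qed.

Lemma supp_empty X : supp 0 0 X -> X = fun _ _ => 0.
Proof.
move=> sX; apply/funext => i; apply/funext => j; apply: sX.
by rewrite /allowed addn0 ltn0 /= [(p <= _)%N]leqNgt; case: (i < p)%N; rewrite ?andbF.
Qed.

Lemma exists_expf_neq1 m : exists2 t : k, t != 0 & t ^+ m.+1 != 1.
Proof.
have : ('X^(m.+2) - 'X : {poly k}) != 0.
  rewrite subr_eq0 -['X in X in _ != X]expr1; apply/eqP.
  by move/(congr1 (fun h : {poly k} => size h)); rewrite !size_polyXn.
case/closed_nonrootP => t; rewrite /root !hornerE subr_eq0 => ne.
exists t; first by apply: contra ne => /eqP ->; rewrite expr0n.
by apply: contra ne => /eqP e; rewrite exprS e mulr1.
Qed.

(** At stage [(0, 0)] the only array is 0, which every scaling fixes; so a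
    nonzero weight forces the value 0. *)
Lemma row_semi_span_base lam P : is_shape p lam -> row_semi 0 0 lam P -> bispan 0 0 lam P.
Proof.
move=> part [_ _ Psc].
have s0 : supp 0 0 (fun _ _ => 0) by [].
have [lam0|pos] := posnP (lam 0%N).
  have ss : sstab 0 0 lam (fun _ _ => 0%N).
    by split=> i j lt_j; have := leq_trans lt_j (shape_le part (leq0n _)); rewrite lam0.
  apply: (@bispan_cons _ _ _ (P (fun _ _ => 0)) (fun _ _ => 0%N) (fun=> 0)) => //.
    exact: bispan_zero.
  move=> X /supp_empty ->; rewrite (bidet_widen (N := 0)) ?lam0 //.
  by rewrite big_ord0 mulr1 addr0.
apply: bispan_zero => X /supp_empty ->.
have lt_p : (0 < p)%N by rewrite ltnNge; apply/negP => /part.2 lam0; rewrite lam0 in pos.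
have [t t_nz t1] := exists_expf_neq1 (lam 0%N).-1; rewrite prednK // in t1.
have /eqP := Psc 0%N t _ lt_p t_nz s0.
have -> : rowscale 0 t (fun _ _ => 0) = fun _ _ => 0.
  by apply/funext => i; apply/funext => j; rewrite /rowscale mulr0 if_same.
rewrite -[X in X == _]mul1r -subr_eq0 -mulrBl mulf_eq0 subr_eq0 eq_sym (negPf t1).
by move/eqP.
Qed.

Theorem row_semi_span q b lam P : (b <= p)%N -> is_shape p lam ->
  row_semi q b lam P -> bispan q b lam P.
Proof.
elim: q b lam P => [|q IHq].
  elim=> [|b IHb] lam P lt_b; first exact: row_semi_span_base.
  apply: row_semi_span_step => // ? ? ?; apply: IHb => //; exact: ltnW.
elim=> [|b IHb] lam P lt_b; last first.
  by apply: row_semi_span_step => // ? ? ?; apply: IHb => //; exact: ltnW.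
move=> part [pP Padd Psc].
have : bispan q p lam P.
  apply: IHq => //; split=> // [i c X lt_i|i t X lt_i t_nz] /supp_wrap; [exact: Padd|exact: Psc].
elim=> {pP Padd Psc P} [P P0|c T Q R ssT _ IH RE].
  by apply: bispan_zero => X /supp_wrap; apply: P0.
apply: (@bispan_cons _ _ _ c T Q) => //; first exact/sstab_wrap.
by move=> X /supp_wrap; apply: RE.
Qed.

(** ** Bideterminants of distinct tableaux are independent *)

Section Independence.

Variable I : finType.
Implicit Types (A : pred I) (c : I -> k).

Definition indep q b := forall lam A c (T : I -> nat -> nat -> nat), is_shape p lam ->
  (forall i, A i -> sstab q b lam (T i)) ->
  (forall i i', A i -> A i' ->
    (forall r j, (j < lam r)%N -> T i r j = T i' r j) -> i = i') ->
  (forall X, supp q b X -> \sum_(i | A i) c i * bidet p lam (T i) X = 0) ->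
  forall i, A i -> c i = 0.

Lemma bidet_indep_base : indep 0 0.
Proof.
move=> lam A c T part ssT Tinj Tsum i Ai.
have lam0 r : lam r = 0%N.
  have [Tal _ _] := ssT i Ai; apply/eqP; rewrite -leqn0 leqNgt; apply/negP => /Tal.
  by rewrite /allowed addn0 ltn0 /= [(p <= _)%N]leqNgt; case: (r < p)%N; rewrite ?andbF.
have := Tsum (fun _ _ => 0) (fun _ _ _ => erefl).
rewrite (bigD1 i) //= big1 ?addr0 => [|i' /andP [Ai' ne]]; last first.
  by case/eqP: ne; apply: Tinj => // r j; rewrite lam0.
by rewrite (bidet_widen (N := 0)) ?lam0 // big_ord0 mulr1.
Qed.

(** Where the new entry [y] vanishes, so do the bideterminants of the tableaux
    with [q] in row [a]; by the previous stage the others have coefficient 0.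
    The remaining sum is divisible by [y], and the quotient is a sum of
    bideterminants of tableaux with one box less. *)
Lemma bidet_indep_step q b : (b < p)%N -> indep q b -> indep q b.+1.
Proof.
move=> lt_b IHb lam; pose a := (p - b.+1)%N.
have abE : (a + b.+1 = p)%N by rewrite subnK.
move en : (lam a) => n; elim: n lam en => [|n IHn] lam en A c T part ssT Tinj Tsum.
  apply: (IHb lam A c T) => // [i Ai|X sX]; last by apply: Tsum; apply: supp_widen.
  by apply: (sstab_no_corner abE (ssT i Ai)); rewrite en.
have pos : (0 < lam a)%N by rewrite en.
pose corner i := T i a (lam a).-1 == q.
have drop i X : A i -> corner i -> supp q b.+1 X ->
    bidet p lam (T i) X = X a q * bidet p (drop_box a lam) (T i) X.
  move=> Ai /eqP ci sX; have part' := sstab_corner_shape abE part (ssT i Ai) pos ci.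
  by apply: bidet_drop_box => // r; apply: (supp_above abE).
have c0 i : A i && ~~ corner i -> c i = 0.
  apply: (IHb lam (fun i => A i && ~~ corner i) c T) => //.
  - move=> i' /andP [Ai' nc]; apply: (sstab_no_corner abE (ssT i' Ai')).
    by rewrite negb_and nc orbT.
  - by move=> i1 i2 /andP [A1 _] /andP [A2 _]; apply: Tinj.
  move=> X sX; have sX1 := supp_widen sX; have := Tsum X sX1.
  rewrite (bigID corner) /= big1 ?add0r // => i' /andP [Ai' ci'].
  by rewrite drop // (supp_corner abE sX) mul0r mulr0.
move=> i Ai; have [ci|nci] := boolP (corner i); last by apply: c0; rewrite Ai.
have part' := sstab_corner_shape abE part (ssT i Ai) pos (eqP ci).
apply: (IHn (drop_box a lam) _ (fun i => A i && corner i) c T) => //.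
- by rewrite /drop_box eqxx en.
- by move=> i' /andP [Ai' _]; apply: sstab_drop_box; apply: ssT.
- move=> i1 i2 /andP [A1 /eqP c1] /andP [A2 /eqP c2] eqT; apply: Tinj => // r j lt_j.
  have [/andP [/eqP -> /eqP ->]|ne] := boolP ((r == a) && (j == (lam a).-1)).
    by rewrite c1 c2.
  apply: eqT; move: ne lt_j; rewrite /drop_box; case: eqP => [->|] //=; lia.
- apply: (polyfun_eq_generic_supp abE (Q := fun=> 0)).
  + apply: polyfun_ext (polyfun_sum (index_enum I)
      (F := fun i X => (A i && corner i)%:R * (c i * bidet p (drop_box a lam) (T i) X)) _).
      move=> X; rewrite [RHS]big_mkcond /=; apply: eq_bigr => i' _.
      by case: ifP; rewrite ?mul1r ?mul0r.
    by move=> i'; do 2![apply: polyfun_mul; first exact: polyfun_const]; exact: polyfun_bidet.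
  + exact: polyfun_const.
  move=> X sX X_nz; apply: (mulfI X_nz); rewrite mulr0 -[RHS](Tsum X sX).
  rewrite [RHS](bigID corner) /= [X in _ + X]big1 ?addr0 => [|i' Ai']; last first.
    by rewrite c0 // mul0r.
  rewrite mulr_sumr; apply: eq_bigr => i' /andP [Ai' ci'].
  by rewrite drop // mulrCA.
- by rewrite Ai.
Qed.

Theorem bidet_indep q b : (b <= p)%N -> indep q b.
Proof.
elim: q b => [|q IHq].
  by elim=> [|b IHb] lt_b; [apply: bidet_indep_base|apply: bidet_indep_step => //; apply/IHb/ltnW].
elim=> [|b IHb] lt_b; last by apply: bidet_indep_step => //; apply/IHb/ltnW.
move=> lam A c T part ssT Tinj Tsum; apply: (IHq p (leqnn p) lam A c T) => //.
  by move=> i /ssT /sstab_wrap.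
by move=> X /supp_wrap; apply: Tsum.
Qed.

End Independence.

End RowSemiInvariants.

(** * The nilpotent orbit and its closure *)

Section PolynomialsOnMatrices.

Variable k : closedFieldType.

Lemma polyfun_mulmx n1 n2 n3 (M : array k -> 'M[k]_(n1, n2)) (N : array k -> 'M[k]_(n2, n3)) :
  (forall i j, polyfun (fun X => M X i j)) -> (forall i j, polyfun (fun X => N X i j)) ->
  forall i j, polyfun (fun X => (M X *m N X) i j).
Proof.
move=> pM pN i j.
apply: polyfun_ext (polyfun_sum (index_enum _) (F := fun l X => M X i l * N X l j) _).
  by move=> X; rewrite mxE.
by move=> l; apply: polyfun_mul.
Qed.

Lemma polyfun_peval n (P : {mpoly k[n * n]}) (M : array k -> 'M[k]_n) :
  (forall i j, polyfun (fun X => M X i j)) -> polyfun (fun X => peval P (M X)).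
Proof.
move=> pM; apply: polyfun_ext (polyfun_sum (msupp P)
  (F := fun m X => P@_m * \prod_i mxvec (M X) 0 i ^+ m i) _) => [X|m].
  by rewrite /peval mevalE.
apply: polyfun_mul; first exact: polyfun_const.
apply: polyfun_prod => i; apply: polyfun_exp.
by case/mxvec_indexP: i => i j; apply: polyfun_ext (pM i j) => X; rewrite mxvecE.
Qed.

End PolynomialsOnMatrices.

Lemma invmx_mul (R : comUnitRingType) n (x y : 'M[R]_n) :
  x \in unitmx -> y \in unitmx -> invmx (x *m y) = invmx y *m invmx x.
Proof.
move=> xU yU; have xyU : x *m y \in unitmx by rewrite unitmx_mul xU.
apply: (can_inj (mulKmx xyU)).
by rewrite mulmxV // mulmxA -(mulmxA x) mulmxV // mulmx1 mulmxV.
Qed.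

Lemma invmx_perm (R : comUnitRingType) n (s : 'S_n) :
  perm_mx s^-1 = invmx (perm_mx s) :> 'M[R]_n.
Proof.
apply: (can_inj (mulKmx (unitmx_perm R s))).
by rewrite mulmxV ?unitmx_perm // -perm_mxM mulgV perm_mx1.
Qed.

Section Orbit.

Variables (k : closedFieldType) (n : nat) (mu : seq nat).
Hypothesis mu_part : is_partition n mu.

Local Notation blk := (reshape_index mu).
Local Notation off := (reshape_offset mu).
Local Notation J := (jordan_nilp k n mu).

(** The transposed Jordan matrix sends each basis vector to the next one of its
    block; the first basis vector then generates the first, longest, block. *)
Definition shift_nilp : 'M[k]_n := J^T.
Local Notation A0 := shift_nilp.

Lemma sumn_mu : sumn mu = n.
Proof. by case/and3P: mu_part => _ _ /eqP. Qed.

Lemma lt_sumn_mu (i : 'I_n) : (i < sumn mu)%N.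
Proof. by rewrite sumn_mu. Qed.

Lemma shift_nilpE i j : A0 i j = ((i == j.+1 :> nat) && (blk i == blk j))%:R.
Proof. by rewrite !mxE [blk j == _]eq_sym. Qed.

(** Reversal of the order inside each block; it conjugates the Jordan matrix
    to its transpose. *)
Definition block_rev (i : nat) := flatten_index mu (blk i) (nth 0%N mu (blk i) - (off i).+1).

Lemma block_rev_lt (i : 'I_n) : (nth 0%N mu (blk i) - (off i).+1 < nth 0%N mu (blk i))%N.
Proof. by have := reshape_offsetP (lt_sumn_mu i); lia. Qed.

Lemma block_rev_ltn (i : 'I_n) : (block_rev i < n)%N.
Proof.
by apply: leq_trans (flatten_indexP (block_rev_lt i)) _; rewrite sumn_mu.
Qed.

Definition block_rev_ord (i : 'I_n) : 'I_n := Ordinal (block_rev_ltn i).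

Lemma blk_rev i : blk (block_rev_ord i) = blk i.
Proof. by rewrite /= flatten_indexKl // block_rev_lt. Qed.

Lemma off_rev i : off (block_rev_ord i) = (nth 0%N mu (blk i) - (off i).+1)%N.
Proof. by rewrite /= flatten_indexKr // block_rev_lt. Qed.

Lemma block_rev_ordK : involutive block_rev_ord.
Proof.
move=> i; apply: val_inj; rewrite [LHS]/= /block_rev off_rev blk_rev.
rewrite -[RHS](reshape_indexK mu); congr flatten_index.
by rewrite -[\val i]/(nat_of_ord i); have := reshape_offsetP (lt_sumn_mu i); lia.
Qed.

Lemma nat_of_blk (i : 'I_n) : (sumn (take (blk i) mu) + off i = i)%N.
Proof. exact: reshape_indexK. Qed.

Lemma succ_blkE (i j : 'I_n) : blk i = blk j ->
  (i == j.+1 :> nat) = (off i == (off j).+1).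
Proof.
move=> e; rewrite -{1}(nat_of_blk i) -{1}(nat_of_blk j) e -addnS.
by rewrite eqn_add2l.
Qed.

Lemma shift_nilp_perm :
  exists s : 'S_n, A0 = perm_mx s *m J *m perm_mx s^-1.
Proof.
pose s := perm (inv_inj block_rev_ordK); exists s.
rewrite -mulmxA -col_permE -row_permE; apply/matrixP => i j.
rewrite shift_nilpE !mxE !permE !blk_rev; congr (nat_of_bool _)%:R.
have [e|ne] := eqVneq (blk i) (blk j); last by rewrite !andbF.
rewrite !andbT [RHS]succ_blkE ?blk_rev // succ_blkE // !off_rev e.
have := reshape_offsetP (lt_sumn_mu i); have := reshape_offsetP (lt_sumn_mu j).
rewrite e; lia.
Qed.

Lemma orbitP (A : 'M[k]_n) : Defs.orbit mu A <->
  exists2 x : 'M[k]_n, x \in unitmx & A = x *m A0 *m invmx x.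
Proof.
have [s sE] := shift_nilp_perm.
have sU : (perm_mx s : 'M[k]_n) \in unitmx by apply: unitmx_perm.
have JE : J = invmx (perm_mx s) *m A0 *m perm_mx s.
  by rewrite sE invmx_perm !mulmxA mulVmx // mul1mx -mulmxA mulVmx // mulmx1.
split=> [[g ->]|[x xU ->]].
  exists (invmx (val g) *m invmx (perm_mx s)).
    by rewrite unitmx_mul !unitmx_inv (valP g).
  rewrite invmx_mul ?unitmx_inv ?(valP g) // !invmxK /conjV JE; by rewrite !mulmxA.
have gU : perm_mx s^-1 *m invmx x \in unitmx by rewrite invmx_perm unitmx_mul !unitmx_inv sU.
exists (exist (fun g => g \in unitmx) _ gU : GL k n); rewrite /conjV /= invmx_perm.
by rewrite invmx_mul ?unitmx_inv // !invmxK JE !mulmxA mulmxK // mulmxK.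
Qed.

Local Notation m := (head 0%N mu).-1.
Hypothesis n_gt0 : (0 < n)%N.

Lemma head_mu_gt0 : (0 < head 0%N mu)%N.
Proof.
case/and3P: mu_part => _; case: mu => [|a s] /=; first by move=> _ /eqP e; move: n_gt0; rewrite -e.
by rewrite inE negb_or eq_sym lt0n => /andP [].
Qed.

Lemma head_mu_le : (head 0%N mu <= n)%N.
Proof. by rewrite -sumn_mu; case: mu => //= a s; apply: leq_addr. Qed.

Lemma nth_mu_le r : (nth 0%N mu r <= head 0%N mu)%N.
Proof.
case/and3P: mu_part => mu_sorted _ _.
have [lt_r|ge_r] := ltnP r (size mu); last by rewrite nth_default.
by rewrite -nth0; apply: (sorted_leq_nth (leT := geq)) => //;
  [exact: rev_trans leq_trans|exact: leqnn|rewrite inE; apply: leq_ltn_trans lt_r].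
Qed.

Lemma blk_eq0 i : (blk i == 0%N) = (i <= m)%N.
Proof.
rewrite -ltnS (prednK head_mu_gt0); have := head_mu_gt0.
rewrite /reshape_index; case: mu => [|a s] //= _; rewrite subn_eq0.
by case: ltnP.
Qed.

Lemma shift_mulS (v : 'cV[k]_n) (i j : 'I_n) :
  j.+1 = i -> blk i = blk j -> (A0 *m v) i 0 = v j 0.
Proof.
move=> ij e; rewrite mxE (bigD1 j) //= shift_nilpE ij e !eqxx mul1r.
rewrite big1 ?addr0 // => l ne; rewrite shift_nilpE -ij eqSS eq_sym val_eqE.
by rewrite (negPf ne) mul0r.
Qed.

Lemma shift_mul0 (v : 'cV[k]_n) (i : 'I_n) :
  (forall j : 'I_n, j.+1 = i -> blk i = blk j -> v j 0 = 0) -> (A0 *m v) i 0 = 0.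
Proof.
move=> v0; rewrite mxE big1 // => j _; rewrite shift_nilpE.
case: eqP => [ij|]; rewrite ?mul0r //; case: eqP => [e|]; rewrite ?mul0r //.
by rewrite v0 ?mulr0.
Qed.

Lemma mulmx_expS (A : 'M[k]_n) t (v : 'cV[k]_n) : A ^+ t.+1 *m v = A *m (A ^+ t *m v).
Proof. by rewrite exprS -mulmxE mulmxA. Qed.

Lemma shift_exp_low t (v : 'cV[k]_n) (i : 'I_n) : (i < t)%N -> (A0 ^+ t *m v) i 0 = 0.
Proof.
elim: t i => // t IHt i lt_i; rewrite mulmx_expS; apply: shift_mul0 => j ij _.
by apply: IHt; rewrite -ltnS ij.
Qed.

Lemma shift_exp_diag t (v : 'cV[k]_n) (i j : 'I_n) : (t <= m)%N -> val i = t ->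
  j = 0%N :> nat -> (A0 ^+ t *m v) i 0 = v j 0.
Proof.
elim: t i => [|t IHt] i le_t it j0.
  by rewrite expr0 mul1mx; congr (v _ _); apply: ord_inj; rewrite j0.
have lt_tn : (t < n)%N by apply: ltnW; rewrite -it; apply: ltn_ord.
rewrite mulmx_expS (shift_mulS _ (j := Ordinal lt_tn)) ?IHt //=.
  exact: ltnW.
by rewrite it; have := blk_eq0 t.+1; have := blk_eq0 t; rewrite le_t ltnW // => /eqP -> /eqP ->.
Qed.

(** An entry at distance [off i] from the start of its block is reached by at
    most [off i] shifts. *)
Lemma shift_exp_off t (v : 'cV[k]_n) (i : 'I_n) : (off i < t)%N -> (A0 ^+ t *m v) i 0 = 0.
Proof.
elim: t i => // t IHt i lt_i; rewrite mulmx_expS; apply: shift_mul0 => j ij e.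
apply: IHt; have := succ_blkE e; rewrite -ij eqxx => /esym /eqP eo.
by move: lt_i; rewrite -ij eo.
Qed.

Lemma shift_nilpotent (v : 'cV[k]_n) : A0 ^+ m.+1 *m v = 0.
Proof.
apply/colP => i; rewrite [RHS]mxE; apply: shift_exp_off; rewrite prednK ?head_mu_gt0 //.
exact: leq_trans (reshape_offsetP (lt_sumn_mu i)) (nth_mu_le _).
Qed.

Lemma shift_exp_first t (i : 'I_n) : (t <= m)%N ->
  (A0 ^+ t *m e_first k n) i 0 = (i == t :> nat)%:R.
Proof.
elim: t i => [|t IHt] i le_t; first by rewrite expr0 mul1mx mxE.
rewrite mulmx_expS; have [it|ne] := eqVneq (i : nat) t.+1.
  have lt_tn : (t < n)%N by apply: ltnW; rewrite -it; apply: ltn_ord.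
  rewrite (shift_mulS _ (j := Ordinal lt_tn)) ?IHt ?eqxx //=.
  - exact: ltnW.
  - by rewrite it; have := blk_eq0 t.+1; have := blk_eq0 t; rewrite le_t ltnW // => /eqP -> /eqP ->.
apply: shift_mul0 => j ij _; rewrite (IHt j (ltnW le_t)).
by move: ne; rewrite -ij eqSS => /negPf ->.
Qed.

(** The scalars that are 1 on the first block and [t] on the others centralize
    the nilpotent matrix. *)
Lemma shift_diag_comm (t : k) :
  let z := diag_mx (\row_(i < n) if (i <= m)%N then 1 else t) in z *m A0 = A0 *m z.
Proof.
apply/matrixP => i j; rewrite mul_diag_mx mul_mx_diag !mxE.
case: eqP => [ij|]; rewrite ?mul0r ?mulr0 //.
case: eqP => [e|]; rewrite ?mul0r ?mulr0 //= mulr1 mul1r.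
by rewrite -!blk_eq0 e.
Qed.

(** The centralizer of the nilpotent matrix moves its first basis vector to any
    vector [v] that has a nonzero first coordinate: the powers of the matrix
    applied to [v] replace the first block, the other blocks stay. *)
Definition chain_mx (v : 'cV[k]_n) : 'M[k]_n :=
  \matrix_(i, j) if (j <= m)%N then (A0 ^+ j *m v) i 0 else (i == j)%:R.

Lemma chain_mx_comm v : A0 *m chain_mx v = chain_mx v *m A0.
Proof.
apply/matrixP => i j; have [le_j|gt_j] := leqP j m.
  have -> : (A0 *m chain_mx v) i j = (A0 ^+ j.+1 *m v) i 0.
    by rewrite mulmx_expS !mxE; apply: eq_bigr => l _; rewrite [chain_mx v l j]mxE le_j.
  rewrite [RHS]mxE; move: le_j; rewrite leq_eqVlt => /orP [/eqP ej|lt_j].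
    rewrite ej shift_nilpotent mxE big1 // => l _; rewrite shift_nilpE.
    case: eqP => [lj|]; rewrite ?mulr0 //; case: eqP => [e|]; rewrite ?mulr0 //.
    have := blk_eq0 l; rewrite e blk_eq0 lj ej leqnn ltnn; by [].
  have lt_jn : (j.+1 < n)%N by apply: leq_trans head_mu_le; rewrite -(prednK head_mu_gt0).
  rewrite (bigD1 (Ordinal lt_jn)) //= big1 ?addr0 => [|l ne]; last first.
    rewrite shift_nilpE; case: eqP => [lj|]; rewrite ?mulr0 //.
    by case/eqP: ne; apply: val_inj.
  rewrite shift_nilpE eqxx /= [chain_mx _ _ _]mxE /= lt_j.
  have := blk_eq0 j.+1; have := blk_eq0 j; rewrite lt_j ltnW // => /eqP -> /eqP ->.
  by rewrite mulr1.
rewrite [RHS]mxE (eq_bigr (fun l => (i == l)%:R * A0 l j)) => [|l _]; last first.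
  rewrite shift_nilpE mxE; have [lj|] := eqVneq (l : nat) j.+1; rewrite ?mulr0 //=.
  by rewrite leqNgt lj ltnS ltnW.
rewrite (bigD1 i) //= eqxx mul1r big1 ?addr0 => [|l ne]; last first.
  by rewrite eq_sym (negPf ne) mul0r.
rewrite mxE (bigD1 j) //= big1 ?addr0 => [|l ne]; rewrite [chain_mx _ _ _]mxE leqNgt gt_j /=.
  by rewrite eqxx mulr1.
by rewrite (negPf ne) mulr0.
Qed.

Lemma chain_mx_unit (v : 'cV[k]_n) (j0 : 'I_n) :
  j0 = 0%N :> nat -> v j0 0 != 0 -> chain_mx v \in unitmx.
Proof.
move=> j00 v_nz; rewrite unitmxE det_trig; last first.
  apply/is_trig_mxP => i j lt_ij; rewrite mxE; case: ifP => [_|_].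
    exact: shift_exp_low.
  by rewrite -val_eqE ltn_eqF.
rewrite unitfE; apply/prodf_neq0 => i _; rewrite mxE eqxx.
by case: ifP => [le_i|_]; rewrite ?oner_neq0 // (shift_exp_diag _ le_i _ j00).
Qed.

Lemma chain_mx_first (v : 'cV[k]_n) (j0 : 'I_n) : j0 = 0%N :> nat -> col j0 (chain_mx v) = v.
Proof. by move=> j00; apply/colP => i; rewrite [LHS]mxE mxE j00 /= expr0 mul1mx. Qed.

End Orbit.

Section OrbitSlice.

Variables (k : closedFieldType) (p : nat) (mu : seq nat).
Hypothesis mu_part : is_partition p.+1 mu.

Local Notation A0 := (shift_nilp k p.+1 mu).

Definition embed (g : 'M[k]_p) : 'M[k]_p.+1 := (block_mx 1%:M 0 0 g : 'M_(1 + p)).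

Lemma det_embed g : \det (embed g) = \det g.
Proof. by apply: etrans (@det_ublock _ 1 p _ _ _) _; rewrite det1 mul1r. Qed.

Lemma embed_unit g : (embed g \in unitmx) = (g \in unitmx).
Proof. by rewrite !unitmxE det_embed. Qed.

Lemma embedM g h : embed (g *m h) = embed g *m embed h.
Proof.
apply/esym; apply: etrans (@mulmx_block _ 1 p 1 p 1 p _ _ _ _ _ _ _ _) _.
by rewrite !mulmx0 !mul0mx !addr0 !add0r mulmx1.
Qed.

Lemma ord_lshift0 : 0 = lshift p (0 : 'I_1) :> 'I_p.+1.
Proof. exact: val_inj. Qed.

Lemma ord_rshift1 (i : 'I_p) : lift 0 i = rshift 1 i :> 'I_p.+1.
Proof. exact: val_inj. Qed.

Lemma embed_lift g (i j : 'I_p) : embed g (lift 0 i) (lift 0 j) = g i j.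
Proof. by rewrite !ord_rshift1; apply: etrans (@block_mxEdr _ 1 p 1 p _ _ _ _ _ _) _. Qed.

Lemma embed_l0 g (i : 'I_p.+1) : embed g i 0 = (i == 0)%:R.
Proof.
case: (unliftP 0 i) => [i' ->|->].
  rewrite (_ : lift 0 i' == 0 = false) // ord_rshift1 ord_lshift0.
  by apply: etrans (@block_mxEdl _ 1 p 1 p _ _ _ _ _ _) _; rewrite mxE.
rewrite eqxx ord_lshift0.
by apply: etrans (@block_mxEul _ 1 p 1 p _ _ _ _ _ _) _; rewrite mxE.
Qed.

Lemma embed_0r g (i : 'I_p.+1) : embed g 0 i = (i == 0)%:R.
Proof.
case: (unliftP 0 i) => [i' ->|->]; last by rewrite embed_l0.
rewrite (_ : lift 0 i' == 0 = false) // ord_rshift1 ord_lshift0.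
by apply: etrans (@block_mxEur _ 1 p 1 p _ _ _ _ _ _) _; rewrite mxE.
Qed.

(** Conjugates under the elements that fix the first basis vector and stabilize
    the span of the others. *)
Definition slice (g : 'M[k]_p) : 'M[k]_p.+1 := embed g *m A0 *m invmx (embed g).

Section Extend.

Variable P : {mpoly k[p.+1 * p.+1]}.
Hypothesis P_inv : forall (u : GL k p.+1) (A : 'M[k]_p.+1), unitriangular u ->
  Defs.orbit mu A -> peval P (conjV u A) = peval P A.
Hypothesis P_slice : forall g, g \in unitmx -> peval P (slice g) = 0.

(** An invertible matrix that fixes the first basis vector is the product of a
    unitriangular one and some [embed g]. *)
Lemma extend_first_col (h : 'M[k]_p.+1) : h \in unitmx ->
  (forall i, h i 0 = (i == 0)%:R) -> peval P (h *m A0 *m invmx h) = 0.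
Proof.
move=> hU h0.
pose g : 'M[k]_p := drsubmx (h : 'M_(1 + p)).
pose r : 'M[k]_(1, p) := ursubmx (h : 'M_(1 + p)).
have hE : h = (block_mx 1%:M r 0 g : 'M_(1 + p)).
  rewrite -[LHS](@submxK _ 1 p 1 p); congr (block_mx _ _ _ _ : 'M_(1 + p)).
    apply/matrixP => i j; rewrite !mxE !ord1 eqxx.
    by rewrite (_ : lshift p 0 = 0) ?h0 //; apply: val_inj.
  apply/matrixP => i j; rewrite !mxE !ord1.
  by rewrite (_ : lshift p 0 = 0) ?h0 //; apply: val_inj.
have gU : g \in unitmx.
  suff dh : \det h = \det g by move: hU; rewrite !unitmxE dh.
  by rewrite hE; apply: etrans (@det_ublock _ 1 p _ _ _) _; rewrite det1 mul1r.
pose u : 'M[k]_p.+1 := (block_mx 1%:M (r *m invmx g) 0 1%:M : 'M_(1 + p)).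
have uU : u \in unitmx.
  rewrite unitmxE; suff -> : \det u = 1 by apply: unitr1.
  by apply: etrans (@det_ublock _ 1 p _ _ _) _; rewrite !det1 mul1r.
have huE : h = u *m embed g.
  rewrite hE; apply/esym; apply: etrans (@mulmx_block _ 1 p 1 p 1 p _ _ _ _ _ _ _ _) _.
  by rewrite !mulmx0 !mul0mx !mul1mx mulmxKV // !addr0 !add0r.
pose U : GL k p.+1 := exist (fun g => g \in unitmx) u uU.
have UU : unitriangular U.
  apply/forallP => i; apply/forallP => j; apply/implyP => le_ji; rewrite [val U]/=.
  case: (unliftP 0 i) le_ji => [i' ->|-> /=]; last first.
    rewrite leqn0 => /eqP j0; have -> : j = 0 by apply: val_inj.
    rewrite ord_lshift0; apply/eqP.
    by apply: etrans (@block_mxEul _ 1 p 1 p _ _ _ _ _ _) _; rewrite mxE !eqxx.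
  case: (unliftP 0 j) => [j' ->|->] _; apply/eqP; rewrite ?ord_rshift1.
    apply: etrans (@block_mxEdr _ 1 p 1 p _ _ _ _ _ _) _; rewrite mxE.
    by rewrite -!ord_rshift1 (inj_eq (@lift_inj _ 0)).
  rewrite ord_lshift0; apply: etrans (@block_mxEdl _ 1 p 1 p _ _ _ _ _ _) _.
  by rewrite mxE.
have eU : embed g \in unitmx by rewrite embed_unit.
rewrite -(@P_inv U) //; last by apply/(orbitP mu_part); exists h.
rewrite -(P_slice gU); congr peval; rewrite /conjV /slice /= huE invmx_mul //.
by rewrite !mulmxA mulVmx // mul1mx mulmxKV.
Qed.

(** An element of the centralizer moves the first basis vector to the first
    column of [invmx x]; after multiplication by it [x] fixes the first basis
    vector. *)
Lemma extend_generic (x : 'M[k]_p.+1) : x \in unitmx -> invmx x 0 0 != 0 ->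
  peval P (x *m A0 *m invmx x) = 0.
Proof.
move=> xU x00; pose v := col 0 (invmx x).
have v0 : v 0 0 != 0 by rewrite mxE.
pose Z := chain_mx mu v.
have ZU : Z \in unitmx by apply: (chain_mx_unit mu_part (ltn0Sn p) (j0 := 0)).
have -> : x *m A0 *m invmx x = (x *m Z) *m A0 *m invmx (x *m Z).
  rewrite invmx_mul // -[x *m Z *m A0]mulmxA -(chain_mx_comm mu_part (ltn0Sn p)).
  rewrite !mulmxA; congr (_ *m _).
  by rewrite -!mulmxA mulmxV // mulmx1.
apply: extend_first_col => [|i]; first by rewrite unitmx_mul xU.
have -> : (x *m Z) i 0 = col 0 (x *m Z) i 0 by rewrite [RHS]mxE.
rewrite colE -mulmxA -colE (chain_mx_first _ _ (j0 := 0)) // /v colE mulmxA.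
by rewrite mulmxV // mul1mx mxE andbT.
Qed.

(** The remaining [x] lie on a line [(1 + t E) x] whose other points are
    generic. *)
Lemma extend_orbit (x : 'M[k]_p.+1) : x \in unitmx ->
  peval P (x *m A0 *m invmx x) = 0.
Proof.
move=> xU; have [x00|] := eqVneq (invmx x 0 0) 0; last exact: extend_generic.
have [j xj] : exists j, invmx x 0 j != 0.
  apply/existsP; apply: contraT; rewrite negb_exists => /forallP x0.
  have : (invmx x *m x) 0 0 = 1 by rewrite mulVmx // mxE.
  rewrite mxE big1 => [/esym/eqP|l _]; first by rewrite oner_eq0.
  by have := x0 l; rewrite negbK => /eqP ->; rewrite mul0r.
have j_nz : j != 0 by apply: contraNneq xj => ->; rewrite x00.
pose E : 'M[k]_p.+1 := delta_mx j 0.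
have E2 : E *m E = 0 by apply: mul_delta_mx_0; rewrite eq_sym.
pose y (t : k) : 'M[k]_p.+1 := 1%:M + t *: E.
have yV t : y t *m y (- t) = 1%:M.
  rewrite /y mulmxDr mulmx1 mulmxDl mul1mx -scalemxAl -scalemxAr E2 !scaler0 addr0.
  by rewrite -addrA -scalerDl subrr scale0r addr0.
have yU t : y t \in unitmx by case/mulmx1_unit: (yV t).
have yI t : invmx (y t) = y (- t).
  by apply: (can_inj (mulKmx (yU t))); rewrite mulmxV // yV.
pose A := x *m A0 *m invmx x.
pose M (X : array k) := y (X 0%N 0%N) *m A *m y (- X 0%N 0%N).
have pM i i' : polyfun (fun X => M X i i').
  have py (c : k) i1 i2 : polyfun (fun X : array k => y (c * X 0%N 0%N) i1 i2).
    apply: polyfun_ext (polyfun_add (polyfun_const ((1%:M : 'M[k]_p.+1) i1 i2))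
      (polyfun_mul (polyfun_const (c * E i1 i2)) (polyfun_entry _ 0 0))) => X.
    by rewrite /y !mxE; ring.
  apply: (polyfun_mulmx (M := fun X => y (X 0%N 0%N) *m A)) => [|i1 i2].
    apply: (polyfun_mulmx (M := fun X => y (X 0%N 0%N)) (N := fun=> A)) => i1 i2.
      by apply: polyfun_ext (py 1 i1 i2) => X; rewrite mul1r.
    exact: polyfun_const.
  by apply: polyfun_ext (py (-1) i1 i2) => X; rewrite mulN1r.
have MA : M (fun _ _ => 0) = A.
  by rewrite /M oppr0 /y scale0r addr0 mul1mx mulmx1.
rewrite -/A -MA; apply: (polyfun_eq_generic (P := fun X => peval P (M X)) (Q := fun=> 0)
  (a := 0%N) (q := 0%N)).
- exact: polyfun_peval.
- exact: polyfun_const.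
(* The entry that has to be nonzero is [- t * invmx x 0 j]. *)
move=> t t_nz; rewrite /M upd_same -yI.
have -> : y t *m A *m invmx (y t) = (y t *m x) *m A0 *m invmx (y t *m x).
  by rewrite invmx_mul // /A !mulmxA.
apply: extend_generic; first by rewrite unitmx_mul yU.
rewrite invmx_mul // yI /y mulmxDr mulmx1 mxE x00 add0r -scalemxAr mxE mulNr oppr_eq0.
rewrite mulf_neq0 // mxE (bigD1 j) //= big1 ?addr0 => [|l ne].
  by rewrite mxE !eqxx mulr1.
by rewrite mxE (negPf ne) mulr0.
Qed.

Lemma extend_closure (A : 'M[k]_p.+1) : A \in orbit_closure k p.+1 mu -> peval P A = 0.
Proof.
rewrite inE => clA; apply: (clA [set B : 'M[k]_p.+1 | peval P B = 0]%classic); split.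
  exists [set P]%classic; apply/seteqP; split=> B /= => [? _ -> //|]; exact.
move=> B /(orbitP mu_part) [x xU ->] /=; exact: extend_orbit.
Qed.

End Extend.

End OrbitSlice.

(** * The semi-invariants attached to tableaux *)

Section Regular.

Variables (k : closedFieldType) (n : nat).

Definition polymx (F : 'M[k]_n -> k) := exists P, forall A, peval P A = F A.

Lemma polymx_const c : polymx (fun=> c).
Proof. by exists c%:MP => A; rewrite /peval mevalC. Qed.

Lemma polymx_entry i j : polymx (fun A => A i j).
Proof. by exists 'X_(mxvec_index i j) => A; rewrite /peval mevalXU mxvecE. Qed.

Lemma polymx_add F G : polymx F -> polymx G -> polymx (fun A => F A + G A).
Proof.
move=> [P PE] [Q QE]; exists (P + Q) => A.
by rewrite /peval mevalD -!/(peval _ A) PE QE.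
Qed.

Lemma polymx_mul F G : polymx F -> polymx G -> polymx (fun A => F A * G A).
Proof.
move=> [P PE] [Q QE]; exists (P * Q) => A.
by rewrite /peval mevalM -!/(peval _ A) PE QE.
Qed.

Lemma polymx_ext F G : F =1 G -> polymx F -> polymx G.
Proof. by move=> /funext ->. Qed.

Lemma polymx_sum (I : Type) (s : seq I) F :
  (forall i, polymx (F i)) -> polymx (fun A => \sum_(i <- s) F i A).
Proof.
move=> pF; elim: s => [|i s IHs].
  by apply: polymx_ext (polymx_const 0) => X; rewrite big_nil.
apply: polymx_ext (polymx_add (pF i) IHs) => X; by rewrite big_cons.
Qed.

Lemma polymx_prod (I : Type) (s : seq I) F :
  (forall i, polymx (F i)) -> polymx (fun A => \prod_(i <- s) F i A).
Proof.
move=> pF; elim: s => [|i s IHs].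
  by apply: polymx_ext (polymx_const 1) => X; rewrite big_nil.
apply: polymx_ext (polymx_mul (pF i) IHs) => X; by rewrite big_cons.
Qed.

Lemma polymx_exp t i j : polymx (fun A => (A ^+ t) i j).
Proof.
elim: t i j => [|t IHt] i j.
  by apply: polymx_ext (polymx_const ((1 : 'M[k]_n) i j)) => A; rewrite expr0.
apply: polymx_ext (polymx_sum (index_enum _) (F := fun l A => A i l * (A ^+ t) l j) _).
  by move=> A; rewrite exprS -mulmxE mxE.
by move=> l; apply: polymx_mul; [apply: polymx_entry|].
Qed.

Lemma polymx_u_tilde lam (T : box lam -> nat) : polymx (u_tilde T).
Proof.
apply: polymx_prod => j; apply: polymx_sum => s; apply: polymx_mul.
  exact: polymx_const.
apply: polymx_prod => a; set t := column T j.
case E: (insub (n - size t + a)%N : option 'I_n) => [i|]; last first.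
  by apply: polymx_ext (polymx_const 0) => A; rewrite mxE E.
apply: polymx_ext (polymx_sum (index_enum _)
  (F := fun l A => (A ^+ nth 0%N t (s a)) i l * e_first k n l 0) _) => [A|l].
  by rewrite mxE E /= mxE [RHS]mxE.
by apply: polymx_mul; [apply: polymx_exp|apply: polymx_const].
Qed.

End Regular.

Lemma diag_GL_neq0 (k : closedFieldType) n (s : GL k n) i :
  is_diag_mx (val s) -> val s i i != 0.
Proof.
move=> s_diag; have := valP s; rewrite unitmxE unitfE det_trig.
  by move/prodf_neq0; apply.
by apply/is_trig_mxP => a b lt_ab; apply: (is_diag_mxP s_diag); rewrite neq_ltn lt_ab.
Qed.

Section BorelSemiInvariance.

Variables (k : closedFieldType) (p : nat).
Local Notation n := p.+1.
Implicit Type A : 'M[k]_n.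

Lemma conjmx_exp (x A : 'M[k]_n) t : x \in unitmx ->
  (x *m A *m invmx x) ^+ t = x *m A ^+ t *m invmx x.
Proof.
move=> xU; elim: t => [|t IHt]; first by rewrite !expr0 mulmx1 mulmxV.
by rewrite !exprS IHt -!mulmxE !mulmxA mulmxKV.
Qed.

Section Window.

Variable l : nat.
Hypothesis le_l : (l <= n)%N.

Lemma top_ord_subproof (a : 'I_l) : (n - l + a < n)%N.
Proof. by have := ltn_ord a; lia. Qed.

Definition top_ord (a : 'I_l) : 'I_n := Ordinal (top_ord_subproof a).

Lemma top_ord_inj : injective top_ord.
Proof. by move=> a b /(congr1 val) /= /addnI /val_inj. Qed.

Lemma mem_top_ord i : (i \in top_ord @: 'I_l) = (n - l <= i)%N.
Proof.
apply/imsetP/idP => [[a _ ->] /=|le_i]; first exact: leq_addr.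
have lt_i : (i - (n - l) < l)%N by have := ltn_ord i; lia.
by exists (Ordinal lt_i) => //; apply: val_inj; rewrite /= subnKC.
Qed.

Lemma row_windowE m (M : 'M[k]_(n, l)) (a b : 'I_l) : m = (n - l)%N ->
  row_window m M a b = M (top_ord a) b.
Proof.
move=> ->; rewrite mxE (insubT (fun i => i < n)%N (top_ord_subproof a)) /=.
by congr (M _ _); apply: val_inj.
Qed.

(** An upper triangular matrix combines each of the last [l] rows with later
    rows only. *)
Lemma row_window_upper (B : 'M[k]_n) (M : 'M[k]_(n, l)) :
  (forall i j : 'I_n, (j < i)%N -> B i j = 0) ->
  \det (row_window (n - l) (B *m M)) =
    (\prod_(a < l) B (top_ord a) (top_ord a)) * \det (row_window (n - l) M).
Proof.
move=> B0; pose W := \matrix_(a < l, b < l) B (top_ord a) (top_ord b).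
have -> : row_window (n - l) (B *m M) = W *m row_window (n - l) M.
  apply/matrixP => a b; rewrite row_windowE // !mxE.
  rewrite (bigID (mem (top_ord @: 'I_l))) /= [X in _ + X]big1 ?addr0.
    rewrite big_imset /=; last by move=> ? ? _ _; apply: top_ord_inj.
    by apply: eq_bigr => c _; rewrite row_windowE // mxE.
  move=> i; rewrite mem_top_ord -ltnNge => lt_i; rewrite B0 ?mul0r //=.
  by apply: leq_trans lt_i _; apply: leq_addr.
rewrite det_mulmx; congr (_ * _); rewrite -det_tr det_trig.
  by apply: eq_bigr => a _; rewrite !mxE.
by apply/is_trig_mxP => a b lt_ab; rewrite !mxE B0 //= ltn_add2l.
Qed.

End Window.

(** The first basis vector is an eigenvector of [b], so up to the eigenvalue
    the columns of the determinant for [conjV b A] are those for [A]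
    multiplied by the inverse of [b]. *)
Lemma u_col_borel (t : seq nat) (b : GL k n) A : (size t <= n)%N ->
  (forall i j : 'I_n, (j < i)%N -> val b i j = 0) ->
  (\prod_(i < n | (n - size t <= i)%N) val b i i) * u_col t (conjV b A) =
    val b 0 0 ^+ size t * u_col t A.
Proof.
move=> le_t b0; have bU := valP b; set B := val b in b0 bU *.
have Be : B *m e_first k n = B 0 0 *: e_first k n.
  apply/colP => i; rewrite !mxE (bigD1 0) //= big1 ?addr0 => [|j j_nz]; last first.
    by rewrite mxE -[_ == _]/(j == 0) (negPf j_nz) mulr0.
  rewrite mxE mulr1; have [->|i_nz] := eqVneq i 0; first by rewrite mulr1.
  by rewrite b0 ?lt0n // -[_ == _]/(i == 0) (negPf i_nz) mulr0.
have conjE t' : B *m (conjV b A ^+ t' *m e_first k n) = B 0 0 *: (A ^+ t' *m e_first k n).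
  have := @conjmx_exp (invmx B) A t'; rewrite unitmx_inv invmxK => /(_ bU).
  rewrite /conjV -/B => ->.
  by rewrite -!mulmxA mulKVmx // Be -scalemxAr.
have powE : B *m power_mx t (conjV b A) (e_first k n) = B 0 0 *: power_mx t A (e_first k n).
  apply/matrixP => i j; have /(congr1 (fun v : 'cV_n => v i 0)) := conjE (nth 0%N t j).
  rewrite mxE [RHS]mxE => E; rewrite mxE [RHS]mxE [X in _ * X]mxE -E.
  by apply: eq_bigr => l _; rewrite mxE.
have := row_window_upper le_t (power_mx t (conjV b A) (e_first k n)) b0.
rewrite powE -/(u_col t _) /u_col => E.
rewrite (eq_bigl (mem (top_ord le_t @: 'I_(size t)))); last first.
  by move=> i; rewrite /= mem_top_ord.
rewrite big_imset /=; last by move=> ? ? _ _; apply: top_ord_inj.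
rewrite (eq_bigl xpredT) // -E -detZ; congr (\det _); apply/matrixP => i j.
by rewrite row_windowE // [RHS]mxE row_windowE // mxE.
Qed.

End BorelSemiInvariance.

(** * Tableaux as functions on boxes and as arrays *)

Section TableauxAsArrays.

Variables (p r : nat) (lam : seq nat).
Hypothesis lam_part : is_partition r lam.
Hypothesis lam_size : (size lam <= p)%N.

Local Notation shape := (nth 0%N lam).

Lemma nth_is_shape : is_shape p shape.
Proof.
case/and3P: lam_part => lam_sorted _ _; split=> i; last first.
  by move=> le_i; rewrite nth_default // (leq_trans lam_size).
have [lt_i|ge_i] := ltnP i.+1 (size lam); last by rewrite nth_default.
apply: (sorted_leq_nth (leT := geq)) => //; [exact: rev_trans leq_trans|exact: leqnn|].
exact: ltnW.
Qed.

Definition box_at i j : option (box lam) :=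
  if insub i is Some i' then if insub j is Some j' then insub (i', j') else None else None.

Definition tab (T : box lam -> nat) i j : nat := oapp T 0%N (box_at i j).

Lemma box_atP i j : (j < shape i)%N ->
  exists b : box lam, [/\ (val b).1 = i :> nat, (val b).2 = j :> nat & box_at i j = Some b].
Proof.
move=> lt_j.
have lt_i : (i < size lam)%N.
  by rewrite ltnNge; apply/negP => le_i; rewrite nth_default in lt_j.
have lt_j0 : (j < head 0%N lam)%N.
  by rewrite -nth0; apply: leq_trans lt_j (shape_le nth_is_shape _).
have lt_b : ((Ordinal lt_i, Ordinal lt_j0).2 < nth 0 lam (Ordinal lt_i, Ordinal lt_j0).1)%N by [].
exists (Sub (Ordinal lt_i, Ordinal lt_j0) lt_b); rewrite /box_at !insubT; split=> //.
Qed.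

Lemma box_at_val (b : box lam) : box_at (val b).1 (val b).2 = Some b.
Proof.
have [b' [e1 e2 ->]] := box_atP (valP b); congr Some; apply: val_inj.
by rewrite [val b]surjective_pairing [val b']surjective_pairing; congr pair; apply: val_inj.
Qed.

Lemma column_eq T (j : 'I_(head 0%N lam)) :
  column T j = [seq tab T i j | i <- iota 0 (col_len p shape j)].
Proof.
pose f i : option nat := omap T (box_at i j).
have pmapE (s : seq 'I_(size lam)) :
    pmap (fun i => omap T (insub (i, j))) s = pmap f (map val s).
  by elim: s => //= i s ->; rewrite /f /box_at !valK.
rewrite /column pmapE val_enum_ord.
set l := col_len p shape j.
have le_l : (l <= size lam)%N.
  rewrite leqNgt; apply/negP; rewrite ltn_col_len ?nth_default //; exact: nth_is_shape.
rewrite -(subnKC le_l) iotaD pmap_cat add0n.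
have -> : pmap f (iota l (size lam - l)) = [::].
  have : all (fun i => l <= i)%N (iota l (size lam - l)).
    by apply/allP => i; rewrite mem_iota => /andP [].
  elim: (iota _ _) => //= i s IHs /andP [le_i /IHs ->].
  suff -> : f i = None by [].
  rewrite /f /box_at; case: insubP => // i' _ ei; case: insubP => // j' _ ej.
  rewrite insubF //= ei ej; move: le_i; rewrite leqNgt ltn_col_len; last exact: nth_is_shape.
  by move/negbTE.
rewrite cats0; have : all (fun i => i < l)%N (iota 0 l).
  by apply/allP => i; rewrite mem_iota.
elim: (iota 0 l) => //= i s IHs /andP [lt_i /IHs ->].
rewrite ltn_col_len in lt_i; last exact: nth_is_shape.
by have [b [_ _ E]] := box_atP lt_i; rewrite /f /tab E.
Qed.

Section SSYT.

Variable m : nat.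

(** Entries are lowered by one, to number the columns of a matrix from 0. *)
Definition array_of_ssyt (S : ssyt lam m) i j : nat := (tab (ssyt_entry S) i j).-1.

Lemma ssyt_tab (S : ssyt lam m) i j : (j < shape i)%N ->
  exists b : box lam, [/\ (val b).1 = i :> nat, (val b).2 = j :> nat,
    tab (ssyt_entry S) i j = ssyt_entry S b & (0 < tab (ssyt_entry S) i j <= m)%N].
Proof.
move=> lt_j; have [b [bi bj E]] := box_atP lt_j; exists b.
rewrite /tab E /=; split=> //; have /andP [/forallP Spos _] := valP S.
by rewrite (Spos b) -ltnS ltn_ord.
Qed.

Lemma sstab_array_of_ssyt (S : ssyt lam m) : sstab p m 0 shape (array_of_ssyt S).
Proof.
have /andP [_ /andP [/forallP rows /forallP cols]] := valP S.
split=> i j lt_j.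
- rewrite /allowed; have [b [_ _ _ /andP [pos le_m]]] := ssyt_tab S lt_j.
  rewrite /array_of_ssyt -ltnS prednK // ltnS le_m andbT.
  by rewrite ltnNge; apply/negP => /(nth_is_shape).2 s0; rewrite s0 in lt_j.
- have [b [bi bj bE /andP [pos _]]] := ssyt_tab S (ltnW lt_j).
  have [c [ci cj cE /andP [pos' _]]] := ssyt_tab S lt_j.
  rewrite /array_of_ssyt -ltnS !prednK // bE cE.
  have /forallP /(_ c) := rows b; rewrite -val_eqE /= bi bj ci cj eqxx leqnSn; exact.
have lt_j' : (j < shape i)%N by apply: leq_trans lt_j ((nth_is_shape).1 _).
have [b [bi bj bE /andP [pos _]]] := ssyt_tab S lt_j'.
have [c [ci cj cE /andP [pos' _]]] := ssyt_tab S lt_j.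
rewrite /array_of_ssyt -ltnS !prednK // bE cE.
have /forallP /(_ c) := cols b; rewrite -val_eqE /= bi bj ci cj eqxx ltnSn; exact.
Qed.

Lemma array_of_ssyt_inj (S S' : ssyt lam m) :
  (forall i j, (j < shape i)%N -> array_of_ssyt S i j = array_of_ssyt S' i j) -> S = S'.
Proof.
move=> E; apply: val_inj; apply/ffunP => b; apply: val_inj.
have lt_b := valP b; have := E _ _ lt_b; rewrite /array_of_ssyt /tab box_at_val /=.
have /andP [/forallP /(_ b) pos _] := valP S; have /andP [/forallP /(_ b) pos' _] := valP S'.
rewrite /ssyt_entry; move: pos pos'.
by case: (val S b) => [[|?] ?]; case: (val S' b) => [[|?] ?] //= _ _ ->.
Qed.

Lemma sstab_lt_col (T : nat -> nat -> nat) i i' j :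
  sstab p m 0 shape T -> (i < i')%N -> (j < shape i')%N ->
  (T i j < T i' j)%N.
Proof.
move=> [_ _ Tcol] /subnKC <-; elim: (i' - i.+1)%N => [|d IHd].
  by rewrite addn0; apply: Tcol.
rewrite addnS => lt_d; apply: ltn_trans (IHd _) (Tcol _ _ lt_d).
by apply: leq_trans lt_d ((nth_is_shape).1 _).
Qed.

Lemma sstab_lt (T : nat -> nat -> nat) i j :
  sstab p m 0 shape T -> (j < shape i)%N -> (T i j < m)%N.
Proof.
move=> [Tal _ _] /Tal; rewrite /allowed addn0 => /andP [lt_i].
by rewrite [(p <= i)%N]leqNgt lt_i andbF orbF.
Qed.

Lemma ssyt_of_sstab (T : nat -> nat -> nat) : sstab p m 0 shape T ->
  exists S : ssyt lam m, forall i j, (j < shape i)%N -> array_of_ssyt S i j = T i j.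
Proof.
move=> ssT; pose F := [ffun b : box lam => inord (T (val b).1 (val b).2).+1 : 'I_m.+1].
have FE b : F b = (T (val b).1 (val b).2).+1 :> nat.
  by rewrite ffunE inordK // ltnS; apply: sstab_lt ssT (valP b).
have FP : [forall b, (0 < F b)%N] && semistandard (fun b => F b).
  apply/andP; split; first by apply/forallP => b; rewrite FE.
  apply/andP; split; apply/forallP => b; apply/forallP => c; apply/implyP => /andP [/eqP e lt_bc].
    rewrite !FE ltnS e; apply: sstab_le_row ssT lt_bc _; exact: valP c.
  rewrite !FE ltnS -e; apply: sstab_lt_col ssT lt_bc _; rewrite e; exact: valP c.
exists (exist _ F FP) => i j lt_j; have [b [bi bj E]] := box_atP lt_j.
by rewrite /array_of_ssyt /tab E /= /ssyt_entry /= FE bi bj.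
Qed.

Lemma ssyt_exists : (size lam <= m)%N -> inhabited (ssyt lam m).
Proof.
move=> le_m; have [|S _] := @ssyt_of_sstab (fun i _ => i); last by constructor.
split=> // i j lt_j; rewrite /allowed.
have lt_i : (i < size lam)%N.
  by rewrite ltnNge; apply/negP => le_i; rewrite nth_default in lt_j.
by rewrite (leq_trans lt_i lam_size) (leq_trans lt_i le_m).
Qed.

(** The first column increases strictly from at least 1 to at most [m]. *)
Lemma ssyt_size : ssyt lam m -> (size lam <= m)%N.
Proof.
move=> S; have ssS := sstab_array_of_ssyt S.
have pos i : (i < size lam)%N -> (0 < shape i)%N.
  case/and3P: lam_part => _ n0 _ lt_i; rewrite lt0n.
  by apply: contra n0 => /eqP <-; apply: mem_nth.
have key i : (i < size lam)%N -> (i <= array_of_ssyt S i 0)%N.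
  elim: i => // i IHi lt_i; apply: leq_ltn_trans (IHi (ltnW lt_i)) _.
  by case: ssS => _ _ cols; apply: cols; apply: pos.
case E: (size lam) => [//|s]; have lt_s : (s < size lam)%N by rewrite E.
by apply: leq_ltn_trans (key s lt_s) (sstab_lt ssS (pos s lt_s)).
Qed.

End SSYT.

End TableauxAsArrays.

(** * Weights of the tableau functions *)

Section TableauWeights.

Variables (k : closedFieldType) (p r : nat) (lam : seq nat).
Hypothesis lam_part : is_partition r lam.
Hypothesis lam_size : (size lam <= p)%N.
Local Notation n := p.+1.
Local Notation shape := (nth 0%N lam).
Let shapeP : is_shape p shape := nth_is_shape lam_part lam_size.

Lemma sum_shape : (\sum_(i < p) shape i = r)%N.
Proof.
case/and3P: lam_part => _ _ /eqP <-.
rewrite sumnE (big_nth 0%N) big_mkord (big_ord_widen _ shape lam_size) [RHS]big_mkcond /=.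
by apply: eq_bigr => i _; case: ltnP => // le_i; rewrite nth_default.
Qed.

Lemma sum_col_lens : (\sum_(j < head 0%N lam) col_len p shape j = r)%N.
Proof.
have lenE j : (col_len p shape j = \sum_(i < p) (i < col_len p shape j))%N.
  rewrite -{1}[col_len p shape j]muln1 -{1}[col_len _ _ _]card_ord -sum_nat_const.
  rewrite (big_ord_widen _ (fun=> 1%N) (col_len_le p shape j)) big_mkcond /=.
  by apply: eq_bigr => i _; case: ltnP.
rewrite (eq_bigr _ (fun (j : 'I_(head 0%N lam)) _ => lenE j)) exchange_big /= -sum_shape.
by apply: eq_bigr => i _; rewrite -(sum_col_len _ shapeP) nth0.
Qed.

Lemma column_size (T : box lam -> nat) j : size (column T j) = col_len p shape j.
Proof. by rewrite (column_eq lam_part lam_size) size_map size_iota. Qed.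

Lemma u_tilde_borel (T : box lam -> nat) (b : GL k n) (A : 'M[k]_n) :
  (forall i j : 'I_n, (j < i)%N -> val b i j = 0) ->
  (\prod_(i < n) val b i i ^+ shape (rev_ord i)) * u_tilde T (conjV b A) =
    val b 0 0 ^+ r * u_tilde T A.
Proof.
move=> b0.
have -> : \prod_(i < n) val b i i ^+ shape (rev_ord i) =
    \prod_(j < head 0%N lam) \prod_(i < n | (n - col_len p shape j <= i)%N) val b i i.
  rewrite (eq_bigr _ (fun j _ => big_mkcond _ _)) exchange_big /=.
  apply: eq_bigr => i _; rewrite -(sum_col_len _ shapeP) -prodrXr nth0.
  apply: eq_bigr => j _; have := col_len_le p shape j; have := ltn_ord i => lt_i le_j.
  case: ifP => h; first by rewrite (_ : (_ < _)%N = true) // /=; lia.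
  by rewrite (_ : (_ < _)%N = false) // /=; lia.
rewrite -sum_col_lens -prodrXr -!big_split /=; apply: eq_bigr => j _.
rewrite -(column_size T j); apply: u_col_borel => //.
by rewrite column_size leqW // col_len_le.
Qed.

End TableauWeights.

(** * Restriction of the tableau functions to the slice *)

Section SliceValues.

Variables (k : closedFieldType) (p : nat) (mu : seq nat).
Hypothesis mu_part : is_partition p.+1 mu.
Local Notation m := (head 0%N mu).-1.
Local Notation n := p.+1.

(** The rows are put in reverse order, since [u_tilde] is built from last rows
    and [bidet] from first ones. *)
Definition array_of_mx (g : 'M[k]_p) : array k := fun i j =>
  if insub i is Some i' then if insub j is Some j' then g (rev_ord i') j' else 0 else 0.

Definition cut_cols (d : nat) (X : array k) : array k := fun i j => if (j < d)%N then X i j else 0.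

Definition rev_sgn l : k := (-1) ^+ (perm (@rev_ord_inj l)).

Lemma rev_sgn_neq0 l : rev_sgn l != 0.
Proof. by rewrite /rev_sgn signr_eq0. Qed.

Lemma det_rev_rows l (M : 'M[k]_l) : \det (\matrix_(a, b) M (rev_ord a) b) = rev_sgn l * \det M.
Proof.
rewrite /rev_sgn -det_perm -det_mulmx -row_permE; congr (\det _).
by apply/matrixP => a b; rewrite !mxE permE.
Qed.

Lemma m_le_p : (m <= p)%N.
Proof. by have := head_mu_le mu_part; lia. Qed.

(** The nilpotent matrix moves the first basis vector along the first block,
    so its powers select columns of [embed g]. The remaining columns of [g] do
    not occur, whence the truncation. *)
Lemma u_col_slice (t : seq nat) (g : 'M[k]_p) : g \in unitmx -> (size t <= p)%N ->
  (forall b, (b < size t)%N -> (0 < nth 0%N t b <= m)%N) ->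
  u_col t (slice mu g) =
    rev_sgn (size t) * minor (size t) (fun b => (nth 0%N t b).-1) (cut_cols m (array_of_mx g)).
Proof.
move=> gU le_t tP; set l := size t in le_t tP *.
have eU : embed g \in unitmx by rewrite embed_unit.
have ee : invmx (embed g) *m e_first k n = e_first k n.
  apply: (can_inj (mulKmx eU)); rewrite mulKVmx //; apply/colP => i.
  rewrite [RHS]mxE (bigD1 0) //= big1 ?addr0 => [|j j_nz].
    by rewrite embed_l0 !mxE mulr1.
  by rewrite [e_first _ _ _ _]mxE -[_ == _]/(j == 0) (negPf j_nz) mulr0.
rewrite /minor -det_rev_rows /u_col -/l; congr (\det _); apply/matrixP => a b.
rewrite (row_windowE (leqW le_t)) // [LHS]mxE [RHS]mxE [RHS]mxE.
have /andP [t_gt0 t_le] := tP b (ltn_ord b).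
have t_lt : ((nth 0%N t b).-1 < p)%N.
  by rewrite prednK //; apply: leq_trans t_le m_le_p.
have a_lt : (p - l + a < p)%N by have := ltn_ord a; lia.
rewrite /slice conjmx_exp // -!mulmxA ee.
have -> : top_ord (leqW le_t) a = lift 0 (Ordinal a_lt).
  by apply: val_inj; rewrite [RHS]lift0 /=; have := ltn_ord a; lia.
rewrite mxE (bigD1 (lift 0 (Ordinal t_lt))) //= big1 ?addr0 => [|j ne]; last first.
  rewrite (shift_exp_first _ mu_part) // (negPf (_ : (j : nat) != _)) ?mulr0 //.
  by apply: contra ne => /eqP ej; apply/eqP/val_inj; rewrite [RHS]lift0 [RHS]prednK.
rewrite (shift_exp_first _ mu_part) // embed_lift.
rewrite (_ : (lift 0 (Ordinal t_lt) == nth 0%N t b :> nat) = true) ?mulr1; last first.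
  by rewrite lift0 prednK ?eqxx.
have lt_m : ((nth 0%N t b).-1 < m)%N by lia.
rewrite /cut_cols lt_m /array_of_mx.
have b_lt : (rev_ord a < p)%N by apply: leq_trans (ltn_ord _) le_t.
rewrite (insubT (fun i => i < p)%N b_lt) (insubT (fun i => i < p)%N t_lt) /=.
by congr (g _ _); apply: val_inj; rewrite //=; have := ltn_ord a; lia.
Qed.

Variables (r : nat) (lam : seq nat).
Hypothesis lam_part : is_partition r lam.
Hypothesis lam_size : (size lam <= p)%N.
Local Notation shape := (nth 0%N lam).
Let shapeP : is_shape p shape := nth_is_shape lam_part lam_size.

Definition shape_sgn : k := \prod_(j < head 0%N lam) rev_sgn (col_len p shape j).

Lemma shape_sgn_neq0 : shape_sgn != 0.
Proof. by apply/prodf_neq0 => j _; apply: rev_sgn_neq0. Qed.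

Lemma u_tilde_slice (S : ssyt lam m) g : g \in unitmx ->
  u_tilde (ssyt_entry S) (slice mu g) =
    shape_sgn * bidet p shape (array_of_ssyt S) (cut_cols m (array_of_mx g)).
Proof.
move=> gU; rewrite /u_tilde /shape_sgn /bidet nth0 -big_split /=; apply: eq_bigr => j _.
set l := col_len p shape j; set t := column _ _.
have tE : t = [seq tab (ssyt_entry S) i j | i <- iota 0 l] by apply: (column_eq lam_part lam_size).
have t_size : size t = l by rewrite tE size_map size_iota.
have t_nth b : (b < l)%N -> nth 0%N t b = tab (ssyt_entry S) b j.
  by move=> lt_b; rewrite tE (nth_map 0%N) ?size_iota // nth_iota.
rewrite u_col_slice //; first last.
- move=> b; rewrite t_size => lt_b; rewrite t_nth //.
  by rewrite ltn_col_len // in lt_b; have [_ [_ _ _]] := ssyt_tab lam_part lam_size S lt_b.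
- by rewrite t_size; apply: col_len_le.
rewrite t_size; congr (_ * _); apply: minor_eq => a b _ lt_b.
by rewrite t_nth.
Qed.

End SliceValues.

(** * Changing the shape and the alphabet *)

Section ShapeAlphabet.

Variables (k : closedFieldType) (p : nat).
Implicit Types (lam : nat -> nat) (T : nat -> nat -> nat) (X : array k) (P : array k -> k).

Lemma allowed0 q i j : allowed p q 0 i j = (i < p)%N && (j < q)%N.
Proof.
rewrite /allowed addn0 [(p <= i)%N]leqNgt; case: (i < p)%N => //=.
by rewrite andbF orbF.
Qed.

Definition widen_shape c lam : nat -> nat := fun i => if (i < p)%N then (lam i + c)%N else 0%N.

Lemma widen_is_shape c lam : is_shape p lam -> is_shape p (widen_shape c lam).
Proof.
move=> [dec _]; rewrite /widen_shape; split=> i; last by rewrite ltnNge => ->.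
by case: ifP => [lt_i|//]; rewrite (ltnW lt_i) leq_add2r.
Qed.

Local Notation full_minor := (@minor k p id).

(** A strictly increasing column of the maximal length [p] with entries below
    [p] can only be 0, 1, ..., p - 1. *)
Lemma bidet_widen_shape c lam T X : (0 < p)%N -> is_shape p lam ->
  sstab p p 0 (widen_shape c lam) T ->
  sstab p p 0 lam (fun i j => T i (c + j)%N) /\
  bidet p (widen_shape c lam) T X =
    full_minor X ^+ c * bidet p lam (fun i j => T i (c + j)%N) X.
Proof.
move=> p_gt0 part [Tal Trow Tcol]; have part' := widen_is_shape c part.
have lt_wide i j : (j < lam i)%N -> (c + j < widen_shape c lam i)%N.
  move=> lt_j; rewrite /widen_shape ifT; first by rewrite addnC ltn_add2r.
  by rewrite ltnNge; apply/negP => /part.2 l0; rewrite l0 in lt_j.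
split.
  split=> i j /lt_wide lt_j.
  - exact: Tal.
  - by rewrite addnS; apply: Trow; rewrite -addnS.
  - exact: Tcol.
have Tfull i j : (j < c)%N -> (i < p)%N -> T i j = i.
  move=> lt_j; have lt_j' i' : (i' < p)%N -> (j < widen_shape c lam i')%N.
    by move=> lt_i; rewrite /widen_shape lt_i ltn_addl.
  have ge e : (e < p)%N -> (e <= T e j)%N.
    elim: e => // e IHe lt_e; apply: leq_ltn_trans (IHe (ltnW lt_e)) _.
    by apply: Tcol; apply: lt_j'.
  have le e : (e < p)%N -> (T (p.-1 - e) j <= p.-1 - e)%N.
    elim: e => [_|e IHe lt_e].
      have lt_p : (p.-1 < p)%N by rewrite prednK.
      by rewrite subn0; have := Tal _ _ (lt_j' _ lt_p); rewrite allowed0 lt_p /=; lia.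
    have := IHe (ltnW lt_e); have e1 : (p.-1 - e = (p.-1 - e.+1).+1)%N by lia.
    have := Tcol (p.-1 - e.+1)%N j; rewrite -e1 => h h'.
    by have := h (lt_j' _ _); rewrite e1 in h' *; lia.
  move=> lt_i; apply/eqP; rewrite eqn_leq ge // andbT.
  by have := le (p.-1 - i)%N; rewrite subKn; [apply; lia|lia].
rewrite (bidet_widen (N := c + lam 0) T X part'); last by rewrite /widen_shape p_gt0 addnC.
rewrite /bidet big_split_ord /=; congr (_ * _).
  rewrite (eq_bigr (fun=> full_minor X)) ?prodr_const ?card_ord // => j _.
  have -> : col_len p (widen_shape c lam) j = p.
    apply: col_len_eq => // i; rewrite /widen_shape; case: (i < p)%N => //.
    by rewrite ltn_addl.
  by apply: minor_eq => a b _ lt_b; rewrite Tfull.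
apply: eq_bigr => j _; congr minor; apply: col_len_eq => // i.
rewrite ltn_col_len // /widen_shape; case: (ltnP i p) => [_|/part.2 ->] //.
by rewrite addnC ltn_add2r.
Qed.

(** Semi-invariant functions on invertible matrices become polynomial after
    multiplication by a power of the determinant. The tableaux that then occur
    start with as many full columns, and these account for that power. *)
Lemma bispan_divide c lam P : (0 < p)%N -> is_shape p lam ->
  bispan p p 0 (widen_shape c lam) P ->
  exists2 Q, polyfun Q /\ bispan p p 0 lam Q &
    forall X, supp p p 0 X -> P X = full_minor X ^+ c * Q X.
Proof.
move=> p_gt0 part; elim=> {P} [P P0|d T P R ssT _ [Q [pQ sQ] QE] RE].
  exists (fun=> 0); first by split; [apply: polyfun_const|apply: bispan_zero].
  by move=> X /P0 ->; rewrite mulr0.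
pose T' i j := T i (c + j)%N.
exists (fun X => d * bidet p lam T' X + Q X).
  split; first by apply: polyfun_add => //; apply: polyfun_mul;
    [apply: polyfun_const|apply: polyfun_bidet].
  by apply: bispan_cons sQ _ => //; case: (bidet_widen_shape (fun _ _ => 0) p_gt0 part ssT).
move=> X sX; rewrite RE // QE //.
by case: (bidet_widen_shape X p_gt0 part ssT) => _ ->; rewrite mulrDr mulrCA.
Qed.

Lemma supp0_le q q' X : (q <= q')%N -> supp p q 0 X -> supp p q' 0 X.
Proof.
move=> le_q sX i j; rewrite allowed0 => nal; apply: sX; rewrite allowed0.
by apply: contra nal => /andP [-> lt_j] /=; apply: leq_trans lt_j le_q.
Qed.

(** On arrays with [q] columns a bideterminant with an entry beyond [q] has a
    zero column. *)
Lemma bispan_restrict q q' lam P : (q <= q')%N -> is_shape p lam ->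
  bispan p q' 0 lam P -> bispan p q 0 lam P.
Proof.
move=> le_q part; elim=> {P} [P P0|d T P R [Tal Trow Tcol] _ IH RE].
  by apply: bispan_zero => X /(supp0_le le_q); apply: P0.
have [ssT|nss] := pselect (sstab p q 0 lam T).
  by apply: (bispan_cons ssT IH) => X /(supp0_le le_q); apply: RE.
apply: bispan_ext IH _ => X sX; rewrite RE; last exact: supp0_le sX.
suff -> : bidet p lam T X = 0 by rewrite mulr0 add0r.
have [i [j [lt_j ge_q]]] : exists i j, (j < lam i)%N /\ (q <= T i j)%N.
  apply: contrapT => none; apply: nss; split=> // i j lt_j; rewrite allowed0.
  have := Tal i j lt_j; rewrite allowed0 => /andP [-> _] /=.
  by rewrite ltnNge; apply/negP => ge_q; apply: none; exists i, j.
have lt_j0 : (j < lam 0)%N by apply: leq_trans lt_j (shape_le part (leq0n _)).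
rewrite /bidet (bigD1 (Ordinal lt_j0)) //= /minor.
have lt_i : (i < col_len p lam j)%N by rewrite ltn_col_len.
rewrite (expand_det_col _ (Ordinal lt_i)) big1 ?mul0r // => a _.
by rewrite mxE sX ?mul0r // allowed0 negb_and -![in X in _ || X]leqNgt /= ge_q orbT.
Qed.

End ShapeAlphabet.

(** * Spanning and independence for the first family *)

Section ClearDenominators.

Variable k : closedFieldType.

Lemma clear_denominators n (P : {mpoly k[n * n]}) (d : array k -> k) (N : array k -> 'M[k]_n) :
  polyfun d -> (forall i j, polyfun (fun X => N X i j)) ->
  exists a Q, polyfun Q /\
    forall X, d X != 0 -> Q X = d X ^+ a * peval P ((d X)^-1 *: N X).
Proof.
move=> pd pN; elim/mpolyind: P => [|c m P _ _ [a [Q [pQ QE]]]].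
  exists 0%N, (fun=> 0); split; first exact: polyfun_const.
  by move=> X _; rewrite /peval meval0 mulr0.
pose M X := \prod_i mxvec (N X) 0 i ^+ m i.
exists (a + mdeg m)%N, (fun X => d X ^+ a * (c * M X) + d X ^+ mdeg m * Q X); split.
  have pM : polyfun M.
    apply: polyfun_prod => i; apply: polyfun_exp.
    by case/mxvec_indexP: i => i j; apply: polyfun_ext (pN i j) => X; rewrite mxvecE.
  apply: polyfun_add; apply: polyfun_mul => //; try exact: polyfun_exp.
  by apply: polyfun_mul => //; apply: polyfun_const.
move=> X d_nz; rewrite QE // /peval mevalD mevalZ mevalX.
have -> : \prod_i mxvec ((d X)^-1 *: N X) 0 i ^+ m i = (d X)^-1 ^+ mdeg m * M X.
  rewrite mdegE -prodrXr -big_split /=; apply: eq_bigr => i _.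
  by rewrite linearZ mxE exprMn.
rewrite exprVn exprD; field; by rewrite expf_neq0.
Qed.

End ClearDenominators.

Section UBasis.

Variables (k : closedFieldType) (p : nat) (mu : seq nat) (r : nat) (lam : seq nat).
Hypothesis p_gt0 : (0 < p)%N.
Hypothesis mu_part : is_partition p.+1 mu.
Hypothesis lam_part : is_partition r lam.
Hypothesis lam_size : (size lam <= p)%N.
Local Notation m := (head 0%N mu).-1.
Local Notation n := p.+1.
Local Notation shape := (nth 0%N lam).
Local Notation C := (orbit_closure k n mu).
Let shapeP : is_shape p shape := nth_is_shape lam_part lam_size.

Definition u_weight := bracket (part_weight n [:: r]) (part_weight n lam).
Local Notation Wu := (semi_invariants k n mu u_weight).

Lemma u_character (s : GL k n) : is_diag_mx (val s) ->
  character u_weight s * \prod_(i < n) val s i i ^+ shape (rev_ord i) = val s 0 0 ^+ r.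
Proof.
move=> s_diag; have s_nz i := diag_GL_neq0 i s_diag.
rewrite /character -big_split /= (bigD1 0) //= [X in _ * X]big1 ?mulr1 => [|i i_nz].
  by rewrite !mxE -[_ ^+ shape _]/(_ ^ (shape _ : int)) -expfzDr // subrK.
rewrite !mxE -[_ ^+ shape _]/(_ ^ (shape _ : int)) -expfzDr // subrK.
by case: (unliftP 0 i) i_nz => [i' ->|->] //; rewrite lift0 /= nth_default.
Qed.

Lemma closure_orbit (A : 'M[k]_n) : Defs.orbit mu A -> A \in C.
Proof. by move=> OA; rewrite inE => Z [_ sub]; apply: sub. Qed.

Lemma u_tilde_semi (S : ssyt lam m) : Wu (restr C (u_tilde (ssyt_entry S))).
Proof.
split.
- have [P PE] := @polymx_u_tilde k n lam (ssyt_entry S).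
  by exists P => A; rewrite PE.
- move=> u /forallP uU; apply/funext => A; rewrite /act /restr /=.
  have uE (i j : 'I_n) : (j <= i)%N -> val u i j = (i == j)%:R.
    by move=> le; have /forallP /(_ j) /implyP /(_ le) /eqP := uU i.
  have := u_tilde_borel lam_part lam_size (ssyt_entry S) (b := u) (val A).
  rewrite big1 => [|i _]; last by rewrite uE // eqxx expr1n.
  rewrite uE // eqxx expr1n !mul1r; apply=> i j lt_ji.
  by rewrite (uE _ _ (ltnW lt_ji)) -val_eqE gtn_eqF.
move=> s s_diag; apply/funext => A; rewrite /act /restr /= /GRing.scale /=.
have := u_tilde_borel lam_part lam_size (ssyt_entry S) (b := s) (val A).
rewrite -u_character // [character _ _ * _]mulrC -mulrA => E.
have /mulfI : \prod_(i < n) val s i i ^+ shape (rev_ord i) != 0; last apply.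
  by apply/prodf_neq0 => i _; rewrite expf_neq0 // diag_GL_neq0.
by apply: E => i j lt_ji; apply: (is_diag_mxP s_diag); rewrite neq_ltn lt_ji orbT.
Qed.

(** ** The slice as a function of an array *)

Definition mx_of_array (X : array k) : 'M[k]_p := \matrix_(i, j) X (rev_ord i) j.

Local Notation full_minor := (@minor k p id).

Lemma det_mx_of_array X : \det (mx_of_array X) = rev_sgn k p * full_minor X.
Proof.
rewrite -det_rev_rows; congr (\det _); by apply/matrixP => i j; rewrite !mxE.
Qed.

Lemma mx_of_array_unit X : (mx_of_array X \in unitmx) = (full_minor X != 0).
Proof. by rewrite unitmxE unitfE det_mx_of_array mulf_eq0 (negPf (rev_sgn_neq0 _ _)). Qed.

Lemma array_of_mxK (g : 'M[k]_p) : mx_of_array (array_of_mx g) = g.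
Proof.
by apply/matrixP => i j; rewrite mxE /array_of_mx !valK rev_ordK.
Qed.

Lemma supp_array_of_mx (g : 'M[k]_p) : supp p p 0 (array_of_mx g).
Proof.
move=> i j; rewrite allowed0 /array_of_mx; case: insubP => // i' -> _; by case: insubP => // j' ->.
Qed.

Lemma mx_of_array_rowadd i c X (lt_i : (i.+1 < p)%N) :
  mx_of_array (rowadd i c X) =
  (1%:M + c *: delta_mx (rev_ord (Ordinal lt_i)) (rev_ord (Ordinal (ltnW lt_i)))) *m mx_of_array X.
Proof.
rewrite mulmxDl mul1mx -scalemxAl; apply/matrixP => a b; rewrite !mxE /rowadd; congr (_ + _).
rewrite (bigD1 (rev_ord (Ordinal (ltnW lt_i)))) //= big1 ?addr0 => [|l ne]; last first.
  by rewrite mxE (negPf ne) andbF mul0r.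
rewrite !mxE rev_ordK eqxx andbT -(inj_eq rev_ord_inj) rev_ordK -val_eqE /=.
by case: eqP; rewrite ?mul1r ?mul0r ?mulr0.
Qed.

Lemma mx_of_array_rowscale i t X :
  mx_of_array (rowscale i t X) =
  diag_mx (\row_a (if rev_ord a == i :> nat then t else 1)) *m mx_of_array X.
Proof.
by rewrite mul_diag_mx; apply/matrixP => a b; rewrite !mxE /rowscale; case: ifP; rewrite ?mul1r.
Qed.

Lemma slice_conjV (u g : 'M[k]_p) (uU : embed u \in unitmx) : g \in unitmx ->
  conjV (exist (fun g => g \in unitmx) (embed u) uU : GL k n) (slice mu (u *m g)) = slice mu g.
Proof.
move=> gU; have eU : embed g \in unitmx by rewrite embed_unit.
rewrite /conjV /slice /= embedM invmx_mul // !mulmxA mulVmx // mul1mx.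
by rewrite mulmxKV.
Qed.

Lemma slice_closure g : g \in unitmx -> slice mu g \in C.
Proof.
by move=> gU; apply: closure_orbit; apply/(orbitP mu_part); exists (embed g); rewrite ?embed_unit.
Qed.

Lemma polyfun_embed (g : array k -> 'M[k]_p) :
  (forall i j, polyfun (fun X => g X i j)) -> forall i j, polyfun (fun X => embed (g X) i j).
Proof.
move=> pg i j; case: (unliftP 0 j) => [j' ->|->]; last first.
  by apply: polyfun_ext (polyfun_const (i == 0)%:R) => X; rewrite embed_l0.
case: (unliftP 0 i) => [i' ->|->].
  by apply: polyfun_ext (pg i' j') => X; rewrite embed_lift.
by apply: polyfun_ext (polyfun_const (lift 0 j' == 0 :> 'I_n)%:R) => X; rewrite embed_0r.
Qed.

Lemma polyfun_adj (g : array k -> 'M[k]_p) :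
  (forall i j, polyfun (fun X => g X i j)) -> forall i j, polyfun (fun X => (\adj (g X)) i j).
Proof.
move=> pg i j; apply: polyfun_ext (polyfun_mul (polyfun_const ((-1) ^+ (j + i)))
   (polyfun_det (M := fun X => row' j (col' i (g X))) _)) => [X|a b].
  by rewrite mxE.
by apply: polyfun_ext (pg (lift j a) (lift i b)) => X; rewrite !mxE.
Qed.

Lemma polyfun_mx_of_array i j : polyfun (fun X => mx_of_array X i j).
Proof. by apply: polyfun_ext (polyfun_entry _ (rev_ord i) j) => X; rewrite mxE. Qed.

(** By Cramer's rule, a polynomial on the slice becomes polynomial after
    multiplication by a power of the determinant. *)
Lemma polyfun_slice (P : {mpoly k[n * n]}) : exists a Q, polyfun Q /\
  forall X, full_minor X != 0 -> Q X = full_minor X ^+ a * peval P (slice mu (mx_of_array X)).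
Proof.
pose h X : 'M[k]_p := (rev_sgn k p)^-1 *: \adj (mx_of_array X).
pose N X := embed (mx_of_array X) *m shift_nilp k n mu *m
  (embed (h X) + (full_minor X - 1) *: delta_mx 0 0).
have pdet : polyfun full_minor by apply: polyfun_minor.
have pN i j : polyfun (fun X => N X i j).
  apply: (polyfun_mulmx (M := fun X => embed (mx_of_array X) *m shift_nilp k n mu)) => [|a b].
    apply: (polyfun_mulmx (M := fun X => embed (mx_of_array X)) (N := fun=> shift_nilp k n mu)).
      exact/polyfun_embed/polyfun_mx_of_array.
    by move=> a b; apply: polyfun_const.
  apply: polyfun_ext (polyfun_add (polyfun_embed (g := h) _ a b)
    (polyfun_mul (polyfun_sub pdet (polyfun_const 1))
       (polyfun_const ((delta_mx 0 0 : 'M[k]_n) a b)))) => [X|a' b'].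
    by rewrite [RHS]mxE [X in _ = _ + X]mxE.
  apply: polyfun_ext (polyfun_mul (polyfun_const (rev_sgn k p)^-1)
    (polyfun_adj polyfun_mx_of_array a' b')) => X.
  by rewrite [RHS]mxE.
have [a [Q [pQ QE]]] := clear_denominators P pdet pN.
exists a, Q; split=> // X d_nz; rewrite QE //; congr (_ * peval _ _).
have gU : mx_of_array X \in unitmx by rewrite mx_of_array_unit.
rewrite /slice /N scalemxAr; congr (_ *m _).
apply: (can_inj (mulKmx (_ : embed (mx_of_array X) \in unitmx))); first by rewrite embed_unit.
rewrite mulmxV ?embed_unit // -scalemxAr.
have hE : mx_of_array X *m h X = (full_minor X)%:M.
  rewrite /h -scalemxAr mul_mx_adj det_mx_of_array scale_scalar_mx mulrA mulVf ?mul1r //.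
  exact: rev_sgn_neq0.
have -> : embed (mx_of_array X) *m
    (embed (h X) + (full_minor X - 1) *: delta_mx 0 0) = (full_minor X)%:M.
  rewrite mulmxDr -embedM hE -scalemxAr; apply/matrixP => i j.
  rewrite [LHS]mxE [X in _ + X]mxE.
  have -> : (embed (mx_of_array X) *m delta_mx 0 0) i j = ((i == 0) && (j == 0))%:R.
    rewrite mxE (bigD1 0) //= big1 ?addr0 => [|l ne]; last first.
      by rewrite [delta_mx _ _ _ _]mxE (negPf ne) mulr0.
    by rewrite embed_l0 [delta_mx _ _ _ _]mxE eqxx /= -natrM mulnb.
  rewrite [RHS]mxE; case: (unliftP 0 j) => [j' ->|->].
    rewrite (_ : lift 0 j' == 0 = false) // andbF mulr0 addr0.
    case: (unliftP 0 i) => [i' ->|->]; last by rewrite embed_0r.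
    by rewrite embed_lift [LHS]mxE (inj_eq (@lift_inj _ 0)).
  rewrite embed_l0 eqxx andbT; case: (i == 0); rewrite /= ?mulr1n ?mulr0n; ring.
by rewrite scale_scalar_mx mulVf.
Qed.

(** The diagonal matrix on the right belongs to the centralizer of the
    nilpotent matrix. *)
Lemma slice_scale_columns (t : k) (g : 'M[k]_p) : t != 0 -> g \in unitmx ->
  slice mu (g *m diag_mx (\row_j if (j < m)%N then 1 else t)) = slice mu g.
Proof.
move=> t_nz gU; set d := diag_mx _.
have dU : d \in unitmx.
  rewrite unitmxE det_diag unitfE; apply/prodf_neq0 => i _; rewrite mxE.
  by case: ifP; rewrite ?oner_neq0.
have comm : embed d *m shift_nilp k n mu = shift_nilp k n mu *m embed d.
  have -> : embed d = diag_mx (\row_(i < n) if (i <= m)%N then 1 else t).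
    apply/matrixP => i j; rewrite [RHS]mxE; case: (unliftP 0 j) => [j' ->|->].
      case: (unliftP 0 i) => [i' ->|->]; last by rewrite embed_0r.
      by rewrite embed_lift [LHS]mxE !mxE !lift0 (inj_eq (@lift_inj _ 0)).
    by rewrite embed_l0 mxE; case: (unliftP 0 i) => [i' ->|->].
  exact: (shift_diag_comm mu_part (ltn0Sn p)).
have eU : embed d \in unitmx by rewrite embed_unit.
rewrite /slice embedM invmx_mul ?embed_unit // -[_ *m embed d *m _]mulmxA comm !mulmxA.
by rewrite mulmxK.
Qed.

Definition colscale (t : k) X : array k := fun i j => if (j < m)%N then X i j else t * X i j.

Lemma mx_of_array_colscale t X :
  mx_of_array (colscale t X) = mx_of_array X *m diag_mx (\row_j if (j < m)%N then 1 else t).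
Proof.
rewrite mul_mx_diag; apply/matrixP => i j; rewrite !mxE /colscale.
by case: ifP; rewrite ?mulr1 // mulrC.
Qed.

Lemma bispan_sum P : bispan p m 0 shape P -> exists c : ssyt lam m -> k,
  forall X, supp p m 0 X -> P X = \sum_S c S * bidet p shape (array_of_ssyt S) X.
Proof.
elim=> {P} [P P0|d T P R ssT _ [c cE] RE].
  by exists (fun=> 0) => X /P0 ->; rewrite big1 // => S _; rewrite mul0r.
have [S SE] := ssyt_of_sstab lam_part lam_size ssT.
exists (fun S' => (S' == S)%:R * d + c S') => X sX; rewrite RE // cE //.
under [RHS]eq_bigr do rewrite mulrDl.
rewrite big_split /= [X in _ = X + _](bigD1 S) //= eqxx mul1r [X in _ = _ + X + _]big1 ?addr0.
  congr (d * _ + _); apply: bidet_eq => // i i' j _ lt_j.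
  by rewrite SE.
by move=> S' /negPf ->; rewrite !mul0r.
Qed.

(** ** Spanning *)

Section Span.

Variables (f : C -> k^o) (P : {mpoly k[n * n]}).
Hypothesis Wf : Wu f.
Hypothesis fP : forall A : C, f A = peval P (val A).

Lemma f_unitriangular (u : GL k n) (A : 'M[k]_n) : unitriangular u -> A \in C ->
  peval P (conjV u A) = peval P A.
Proof.
case: Wf => _ fU _ uU AC; have := congr1 (fun h => h (exist _ A AC)) (fU u uU).
by rewrite /act !fP.
Qed.

Lemma f_diag (s : GL k n) (A : 'M[k]_n) : is_diag_mx (val s) -> A \in C ->
  peval P (conjV s A) = character u_weight s * peval P A.
Proof.
case: Wf => _ _ fD sD AC; have := congr1 (fun h => h (exist _ A AC)) (fD s sD).
by rewrite /act /= fP /GRing.scale /= fP.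
Qed.

Lemma slice_unip (u g : 'M[k]_p) : u \in unitmx -> g \in unitmx ->
  (forall i j : 'I_p, (j <= i)%N -> u i j = (i == j)%:R) ->
  peval P (slice mu (u *m g)) = peval P (slice mu g).
Proof.
move=> uU gU u_tri; have euU : embed u \in unitmx by rewrite embed_unit.
rewrite -(slice_conjV euU gU) f_unitriangular //; last first.
  by apply: slice_closure; rewrite unitmx_mul uU.
apply/forallP => i; apply/forallP => j; apply/implyP; rewrite [val _]/=.
case: (unliftP 0 j) => [j' ->|-> _]; last by rewrite embed_l0.
case: (unliftP 0 i) => [i' ->|->]; last by rewrite lift0.
by rewrite !lift0 ltnS embed_lift => /u_tri ->; rewrite (inj_eq (@lift_inj _ 0)).
Qed.

Lemma slice_diag (d : 'rV[k]_p) (g : 'M[k]_p) : (forall i, d 0 i != 0) -> g \in unitmx ->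
  peval P (slice mu (diag_mx d *m g)) =
    (\prod_i d 0 i ^+ shape (rev_ord i)) * peval P (slice mu g).
Proof.
move=> d_nz gU; have dU : diag_mx d \in unitmx.
  by rewrite unitmxE det_diag unitfE; apply/prodf_neq0 => i _.
have euU : embed (diag_mx d) \in unitmx by rewrite embed_unit.
pose s : GL k n := exist (fun g => g \in unitmx) (embed (diag_mx d)) euU.
have sD : is_diag_mx (val s).
  apply/is_diag_mxP => i j; rewrite [val _]/=.
  case: (unliftP 0 j) => [j' ->|->]; last first.
    by rewrite embed_l0 => /negPf; case: (unliftP 0 i) => [i' ->|->].
  case: (unliftP 0 i) => [i' ->|->]; last by rewrite embed_0r.
  by rewrite embed_lift mxE !lift0 eqSS -val_eqE => /negPf /= ->.
rewrite -(slice_conjV euU gU) -/s f_diag //; last by apply: slice_closure; rewrite unitmx_mul dU.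
suff chi1 : (\prod_i d 0 i ^+ shape (rev_ord i)) * character u_weight s = 1.
  by rewrite mulrA chi1 mul1r.
have := u_character sD; rewrite big_ord_recl [val s 0 0]embed_0r eqxx !expr1n mul1r => E.
rewrite -[RHS]E mulrC; congr (_ * _); apply: eq_bigr => i _.
by rewrite [val s _ _]embed_lift mxE eqxx mulr1n; congr (_ ^+ shape _).
Qed.

(** On the slice, [f] becomes a function of [g] that row operations leave
    invariant. It is a combination of bideterminants of [g], after clearing
    denominators and cancelling full columns; letting the scalar [t] of
    [slice_scale_columns] tend to 0 leaves the entries below [m], where
    bideterminants are the restrictions of [u_tilde]. *)
Lemma slice_span : exists c : ssyt lam m -> k, forall g, g \in unitmx ->
  peval P (slice mu g) = \sum_S c S * u_tilde (ssyt_entry S) (slice mu g).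
Proof.
have [a [Q [pQ QE]]] := polyfun_slice P.
(* The extra factor makes the invariance hold trivially where the determinant
   vanishes. *)
pose Phi X := full_minor X * Q X.
have PhiE X : full_minor X != 0 ->
    Phi X = full_minor X ^+ a.+1 * peval P (slice mu (mx_of_array X)).
  by move=> d_nz; rewrite /Phi QE // mulrA -exprS.
have sPhi : row_semi p p 0 (widen_shape p a.+1 shape) Phi.
  split=> [|i c X lt_i _|i t X lt_i t_nz _].
  - by apply: polyfun_mul => //; apply: polyfun_minor.
  - have d_eq : full_minor (rowadd i c X) = full_minor X by apply: minor_rowadd.
    have [d0|d_nz] := eqVneq (full_minor X) 0; first by rewrite /Phi d_eq d0 !mul0r.
    have gU : mx_of_array X \in unitmx by rewrite mx_of_array_unit.
    rewrite !PhiE ?d_eq // mx_of_array_rowadd; congr (_ * _).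
    set u := 1%:M + _; have uE (i' j : 'I_p) : (j <= i')%N -> u i' j = (i' == j)%:R.
      move=> le_j; rewrite [LHS]mxE [X in X + _]mxE !mxE.
      rewrite (_ : (_ && _) = false) ?mulr0 ?addr0 //; apply: contraTF le_j.
      move=> /andP [/eqP -> /eqP ->]; rewrite -ltnNge /=; lia.
    apply: slice_unip => //; rewrite unitmxE -det_tr det_trig.
      by rewrite big1 ?unitr1 // => j _; rewrite mxE uE // eqxx.
    by apply/is_trig_mxP => i' j lt_ij; rewrite mxE uE ?(ltnW lt_ij) // -val_eqE gtn_eqF.
  have d_eq : full_minor (rowscale i t X) = t * full_minor X.
    by rewrite minor_rowscale lt_i expr1.
  have [d0|d_nz] := eqVneq (full_minor X) 0; first by rewrite /Phi d_eq d0 !(mulr0, mul0r).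
  have gU : mx_of_array X \in unitmx by rewrite mx_of_array_unit.
  rewrite !PhiE ?d_eq ?mulf_neq0 // mx_of_array_rowscale slice_diag //; last first.
    by move=> j; rewrite mxE; case: ifP; rewrite ?oner_neq0.
  rewrite (bigD1 (rev_ord (Ordinal lt_i))) //= big1 ?mulr1 => [|j ne]; last first.
    rewrite mxE ifF ?expr1n //; apply: contra_neqF ne => /eqP ej.
    by apply: (canRL rev_ordK); apply: val_inj.
  rewrite mxE /= (_ : (p - (p - i.+1).+1)%N = i); last by lia.
  rewrite eqxx /widen_shape lt_i exprD exprMn.
  by ring.
have part' := widen_is_shape a.+1 shapeP.
have [Psi [pPsi sPsi] PsiE] :=
  bispan_divide p_gt0 shapeP (row_semi_span (leq0n p) part' sPhi).
have PsiE' X : supp p p 0 X -> full_minor X != 0 -> Psi X = peval P (slice mu (mx_of_array X)).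
  move=> sX d_nz; have := PsiE X sX; rewrite PhiE // => /mulfI ->//.
  by rewrite expf_neq0.
have cutE g : g \in unitmx -> peval P (slice mu g) = Psi (cut_cols m (array_of_mx g)).
  move=> gU; have d_nz : full_minor (array_of_mx g) != 0 by rewrite -mx_of_array_unit array_of_mxK.
  rewrite -{1}[g]array_of_mxK.
  pose Y i j : {poly k} :=
    if (j < m)%N then (array_of_mx g i j)%:P else 'X * (array_of_mx g i j)%:P.
  have YE t : (fun i j => (Y i j).[t]) = colscale t (array_of_mx g).
    apply/funext => i; apply/funext => j; rewrite /Y /colscale.
    by case: ifP; rewrite !hornerE.
  have [h hE] := polyfun_curve Y pPsi.
  have h_cst : h - (peval P (slice mu (mx_of_array (array_of_mx g))))%:P = 0.
    apply: poly_eq0_punctured => t t_nz; rewrite hornerD hornerN hornerC hE YE.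
    have := mx_of_array_colscale t (array_of_mx g) => E.
    rewrite PsiE'; last first.
    - rewrite -mx_of_array_unit E unitmx_mul array_of_mxK gU /= unitmxE det_diag unitfE.
      by apply/prodf_neq0 => j _; rewrite mxE; case: ifP; rewrite ?oner_neq0.
    - move=> i j nal; have := supp_array_of_mx g nal; rewrite /colscale => ->.
      by rewrite mulr0 if_same.
    by rewrite E slice_scale_columns ?subrr // array_of_mxK.
  have := hE 0; move/subr0_eq: h_cst => ->; rewrite hornerC YE => ->; congr Psi.
  by apply/funext => i; apply/funext => j; rewrite /colscale /cut_cols mul0r.
have [c cE] := bispan_sum (bispan_restrict (m_le_p mu_part) shapeP sPsi).
exists (fun S => c S / shape_sgn k p lam) => g gU; rewrite cutE // cE; last first.
  move=> i j; rewrite allowed0 /cut_cols; case: (ltnP j m) => // _; rewrite andbT.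
  by move=> nal; apply: (supp_array_of_mx g); rewrite allowed0 (negPf nal).
apply: eq_bigr => S _; rewrite (u_tilde_slice mu_part lam_part lam_size) //.
by rewrite mulrA mulfVK // shape_sgn_neq0.
Qed.

Lemma u_span_f : exists c : ssyt lam m -> k,
  f = \sum_S c S *: (restr C (u_tilde (ssyt_entry S)) : C -> k^o).
Proof.
have [c cE] := slice_span; exists c.
have [D DE] : polymx (fun A => peval P A + \sum_S (- c S) * u_tilde (ssyt_entry S) A).
  apply: polymx_add; first by exists P.
  by apply: polymx_sum => S; apply: polymx_mul; [apply: polymx_const|apply: polymx_u_tilde].
have D0 (A : C) : peval D (val A) = 0.
  apply: (extend_closure mu_part) (valP A) => [u B uU OB|g gU].
    rewrite !DE (f_unitriangular uU); last exact: closure_orbit.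
    congr (_ + _); apply: eq_bigr => S _; congr (_ * _).
    have BC := closure_orbit OB; case: (u_tilde_semi S) => _ UU _.
    have := congr1 (fun h => h (exist _ B BC)) (UU u uU); exact.
  rewrite DE cE // -big_split big1 //= => S _; by rewrite mulNr subrr.
apply/funext => A; have := D0 A; rewrite DE fP => /eqP; rewrite addr_eq0 => /eqP ->.
rewrite fct_sumE -sumrN; apply: eq_bigr => S _.
by rewrite mulNr opprK.
Qed.

End Span.

(** A relation on the slice is a relation between bideterminants of the first
    [m] columns of invertible matrices, and these columns are arbitrary up to
    closure. *)
Lemma u_indep (c : ssyt lam m -> k) :
  \sum_S c S *: (restr C (u_tilde (ssyt_entry S)) : C -> k^o) = 0 -> forall S, c S = 0.
Proof.
move=> c0; pose B X := \sum_S c S * bidet p shape (array_of_ssyt S) X.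
have B0 (g : 'M[k]_p) : g \in unitmx -> B (cut_cols m (array_of_mx g)) = 0.
  move=> gU; pose A : C := exist (fun A => A \in C) _ (slice_closure gU).
  have := congr1 (fun h : C -> k^o => h A) c0.
  rewrite fct_sumE /GRing.scale /= /restr /= => E.
  apply: (mulfI (shape_sgn_neq0 k p lam)); rewrite mulr0 -[RHS]E mulr_sumr.
  apply: eq_bigr => S _; rewrite (u_tilde_slice mu_part lam_part lam_size) //.
  by rewrite mulrCA.
have pB : polyfun B.
  by apply: polyfun_sum => S; apply: polyfun_mul; [apply: polyfun_const|apply: polyfun_bidet].
have Bsupp X : supp p m 0 X -> B X = 0.
  move=> sX; have sX' := supp0_le (m_le_p mu_part) sX.
  (* A line through [X] and through the array of the identity matrix. *)
  pose Y i j : {poly k} := (X i j)%:P + 'X * (array_of_mx (1%:M : 'M[k]_p) i j - X i j)%:P.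
  have YE z i j : (Y i j).[z] = X i j + z * (array_of_mx (1%:M : 'M[k]_p) i j - X i j).
    by rewrite /Y !hornerE.
  have pd : polyfun full_minor by apply: polyfun_minor.
  have pcut : polyfun (fun Z => B (cut_cols m Z)).
    apply: (polyfun_comp (Y := cut_cols m)) => // i j; rewrite /cut_cols; case: (j < m)%N.
      exact: polyfun_entry.
    exact: polyfun_const.
  have [g gE] := polyfun_curve Y pd; have [h hE] := polyfun_curve Y pcut.
  have g_nz : g != 0.
    have : g.[1] != 0.
      rewrite gE (_ : (fun i j => (Y i j).[1]) = array_of_mx (1%:M : 'M[k]_p)).
        by rewrite -mx_of_array_unit array_of_mxK unitmx1.
      by apply/funext => i; apply/funext => j; rewrite YE; ring.
    by apply: contra_neq => ->; rewrite horner0.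
  have h0 : h = 0.
    apply: (poly_eq0_generic g_nz) => z; rewrite gE hE -mx_of_array_unit.
    set Z := fun i j => _; have sZ : Z = array_of_mx (mx_of_array Z).
      apply/funext => i; apply/funext => j; rewrite [RHS]/array_of_mx.
      case: insubP => [i' _ ei|ni]; last first.
        rewrite /Z YE (sX' i j) ?allowed0 ?(negPf ni) // (supp_array_of_mx _ (i := i)).
          by rewrite subr0 mulr0 addr0.
        by rewrite allowed0 (negPf ni).
      case: insubP => [j' _ ej|nj]; first by rewrite mxE rev_ordK ei ej.
      rewrite /Z YE (sX' i j) ?allowed0 ?(negPf nj) ?andbF // (supp_array_of_mx _ (j := j)).
        by rewrite subr0 mulr0 addr0.
      by rewrite allowed0 (negPf nj) andbF.
    by move=> ZU; rewrite sZ B0.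
  have := hE 0; rewrite h0 horner0 => ->; congr B.
  apply/funext => i; apply/funext => j; rewrite /cut_cols YE mul0r addr0.
  by case: ifP => // nj; rewrite sX // allowed0 nj andbF.
move=> S; have := @bidet_indep k p (ssyt lam m) m 0 (leq0n p) shape predT c
  (@array_of_ssyt lam m) shapeP.
apply=> // [S' _|S1 S2 _ _].
  exact: (sstab_array_of_ssyt lam_part lam_size).
exact: (array_of_ssyt_inj lam_part lam_size).
Qed.

Theorem u_basis : is_basis Wu (fun S : ssyt lam m => restr C (u_tilde (ssyt_entry S))).
Proof.
split=> [S|c|f Wf]; first exact: u_tilde_semi.
  exact: u_indep.
by have [[P fP] _ _] := Wf; apply: (u_span_f Wf fP).
Qed.

End UBasis.

(** * The anti-transposition exchanges the two families *)

Section Antitranspose.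

Variables (k : closedFieldType) (n : nat).
Implicit Types A B : 'M[k]_n.

(** Reflection in the second diagonal: an anti-automorphism that preserves the
    upper triangular matrices and exchanges the first and the last basis
    vector. *)
Definition antitr A : 'M[k]_n := \matrix_(i, j) A (rev_ord j) (rev_ord i).

Lemma antitrK : involutive antitr.
Proof. by move=> A; apply/matrixP => i j; rewrite !mxE !rev_ordK. Qed.

Lemma antitrM A B : antitr (A *m B) = antitr B *m antitr A.
Proof.
apply/matrixP => i j; rewrite !mxE (reindex_inj rev_ord_inj) /=.
by apply: eq_bigr => l _; rewrite !mxE mulrC.
Qed.

Lemma antitr1 : antitr 1%:M = 1%:M.
Proof. by apply/matrixP => i j; rewrite !mxE (inj_eq rev_ord_inj) eq_sym. Qed.

Lemma antitr_exp A t : antitr (A ^+ t) = antitr A ^+ t.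
Proof.
elim: t => [|t IHt]; first by rewrite !expr0 antitr1.
by rewrite exprSr exprS -!mulmxE antitrM IHt.
Qed.

Lemma antitr_unit A : (antitr A \in unitmx) = (A \in unitmx).
Proof.
suff imp B : B \in unitmx -> antitr B \in unitmx.
  by apply/idP/idP => /imp //; rewrite antitrK.
move=> BU; case: (@mulmx1_unit _ _ (antitr B) (antitr (invmx B))) => //.
by rewrite -antitrM mulVmx // antitr1.
Qed.

Lemma antitrV A : A \in unitmx -> antitr (invmx A) = invmx (antitr A).
Proof.
move=> AU; have tU : antitr A \in unitmx by rewrite antitr_unit.
by apply: (can_inj (mulKmx tU)); rewrite mulmxV // -antitrM mulVmx // antitr1.
Qed.

Lemma polymx_peval (P : {mpoly k[n * n]}) (M : 'M[k]_n -> 'M[k]_n) :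
  (forall i j, polymx (fun A => M A i j)) -> polymx (fun A => peval P (M A)).
Proof.
move=> pM; apply: polymx_ext (polymx_sum (msupp P)
  (F := fun m A => P@_m * \prod_i mxvec (M A) 0 i ^+ m i) _) => [A|m].
  by rewrite /peval mevalE.
apply: polymx_mul; first exact: polymx_const.
apply: polymx_prod => i; case/mxvec_indexP: i => i j.
apply: polymx_ext (polymx_prod (index_enum 'I_(m (mxvec_index i j))) (F := fun _ A => M A i j) _).
  by move=> A; rewrite prodr_const card_ord mxvecE.
by move=> _; apply: pM.
Qed.

Lemma polymx_antitr (P : {mpoly k[n * n]}) : polymx (fun A => peval P (antitr A)).
Proof.
apply: polymx_peval => i j.
by apply: polymx_ext (polymx_entry _ (rev_ord j) (rev_ord i)) => A; rewrite mxE.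
Qed.

Section OrbitStable.

Variable mu : seq nat.
Hypothesis mu_part : is_partition n mu.

(** The reflection of the transposed Jordan matrix is the Jordan matrix with
    its basis in reverse order. *)
Lemma orbit_antitr A : Defs.orbit mu A -> Defs.orbit mu (antitr A).
Proof.
move=> /(orbitP mu_part) [x xU ->]; have [s sE] := shift_nilp_perm k mu_part.
pose w : 'S_n := perm (@rev_ord_inj n).
have sU : (perm_mx s : 'M[k]_n) \in unitmx by apply: unitmx_perm.
have wU : (perm_mx w : 'M[k]_n) \in unitmx by apply: unitmx_perm.
have A0E : antitr (shift_nilp k n mu) =
    perm_mx w *m jordan_nilp k n mu *m invmx (perm_mx w).
  rewrite -(invmx_perm k w) -mulmxA -col_permE -row_permE; apply/matrixP => i j.
  by rewrite [LHS]mxE [LHS]mxE [RHS]mxE [RHS]mxE !permE.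
have JE : jordan_nilp k n mu = invmx (perm_mx s) *m shift_nilp k n mu *m perm_mx s.
  by rewrite sE (invmx_perm k s) !mulmxA mulVmx // mul1mx mulmxKV.
apply/(orbitP mu_part); exists (invmx (antitr x) *m perm_mx w *m invmx (perm_mx s)).
  by rewrite !unitmx_mul !unitmx_inv antitr_unit xU wU.
have xU' : invmx (antitr x) \in unitmx by rewrite unitmx_inv antitr_unit.
rewrite !antitrM antitrV // A0E JE !invmx_mul ?unitmx_inv ?unitmx_mul ?xU' ?antitr_unit ?sU ?wU //.
by rewrite !invmxK !mulmxA.
Qed.

Local Notation C := (orbit_closure k n mu).

Lemma closure_antitr A : A \in C -> antitr A \in C.
Proof.
rewrite !inE => clA Z [[S ->] sub] P SP.
have [Q QE] := polymx_antitr P.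
rewrite -QE; apply: (clA [set B : 'M[k]_n | peval Q B = 0]%classic); split.
  exists [set Q]%classic; apply/seteqP; split=> B /= => [? _ -> //|]; exact.
by move=> B OB /=; rewrite QE; apply: (sub _ (orbit_antitr OB)).
Qed.

Definition closure_antitr_fun (A : C) : C :=
  exist (fun A => A \in C) (antitr (val A)) (closure_antitr (valP A)).

Lemma closure_antitr_funK : involutive closure_antitr_fun.
Proof. by move=> A; apply: val_inj; rewrite /= antitrK. Qed.

Lemma GL_antitr_subproof (g : GL k n) : antitr (val g) \in unitmx.
Proof. by rewrite antitr_unit (valP g). Qed.

Definition GL_antitr (g : GL k n) : GL k n :=
  exist (fun g => g \in unitmx) (antitr (val g)) (GL_antitr_subproof g).

Lemma conjV_antitr (g : GL k n) A :
  conjV (GL_antitr g) (antitr (conjV g A)) = antitr A.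
Proof.
rewrite /conjV /= !antitrM antitrV ?(valP g) // !mulmxA mulVmx ?GL_antitr_subproof //.
by rewrite mul1mx mulmxKV // GL_antitr_subproof.
Qed.

(** Being an anti-automorphism, the reflection turns conjugation by [g] into
    conjugation by the inverse of [antitr g]; it thus reverses and negates
    weights. *)
Lemma semi_antitr (a b : 'rV[int]_n) (f : C -> k^o) :
  semi_invariants k n mu (bracket b a) f ->
  semi_invariants k n mu (bracket a b) (f \o closure_antitr_fun).
Proof.
case=> [[P PE] fU fD]; split.
- have [Q QE] := polymx_antitr P.
  by exists Q => A; rewrite QE /= PE.
- move=> u uU; apply/funext => A; rewrite /act /=.
  set B := closure_antitr_fun _; have uU' : unitriangular (GL_antitr u).
    apply/forallP => i; apply/forallP => j; apply/implyP => le_ji.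
    rewrite /= mxE; have /forallP /(_ (rev_ord j)) /forallP /(_ (rev_ord i)) := uU.
    by rewrite (inj_eq rev_ord_inj) [i == j]eq_sym; move/implyP; apply => /=; lia.
  have /(congr1 (fun h : C -> k^o => h B)) := fU _ uU'; rewrite /act => <-; congr f.
  by apply: val_inj; rewrite /= conjV_antitr.
move=> s sD; apply/funext => A; rewrite /act /=.
set B := closure_antitr_fun _; have sD' : is_diag_mx (val (GL_antitr s)).
  apply/is_diag_mxP => i j ne; rewrite mxE (is_diag_mxP sD) //.
  by apply: contra ne => /eqP e; rewrite (rev_ord_inj (ord_inj e)).
have s_nz i := diag_GL_neq0 i sD.
have chi1 : character (bracket a b) s * character (bracket b a) (GL_antitr s) = 1.
  rewrite /character [X in _ * X](reindex_inj rev_ord_inj) -big_split big1 //= => i _.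
  rewrite !mxE !rev_ordK -expfzDr // (_ : _ + _ = 0) ?expr0z //; ring.
have /(congr1 (fun h : C -> k^o => h B)) := fD _ sD'; rewrite /act.
have -> : exist (fun x => x \in C) (conjV (GL_antitr s) (val B))
    (orbit_closure_conjV (GL_antitr s) (valP B)) = closure_antitr_fun A.
  by apply: val_inj; rewrite /= conjV_antitr.
rewrite /GRing.scale /= /GRing.scale /= => ->; by rewrite mulrA chi1 mul1r.
Qed.

End OrbitStable.

End Antitranspose.

Section VBasis.

Variables (k : closedFieldType) (p : nat) (mu : seq nat) (r : nat) (lam : seq nat).
Hypothesis p_gt0 : (0 < p)%N.
Hypothesis mu_part : is_partition p.+1 mu.
Hypothesis lam_part : is_partition r lam.
Hypothesis lam_size : (size lam <= p)%N.
Local Notation n := p.+1.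
Local Notation m := (head 0%N mu).-1.
Local Notation C := (orbit_closure k n mu).

Lemma u_col_antitr (t : seq nat) (A : 'M[k]_n) : (size t <= n)%N ->
  u_col t (antitr A) = rev_sgn k (size t) * v_col t A.
Proof.
move=> le_t; rewrite /v_col -det_rev_rows; congr (\det _); apply/matrixP => a b.
rewrite (row_windowE le_t) // [LHS]mxE [RHS]mxE [RHS]mxE add0n.
have lt_a : (rev_ord a < n)%N by apply: leq_trans (ltn_ord _) le_t.
rewrite (insubT (fun i => i < n)%N lt_a) /= [RHS]mxE.
rewrite [LHS]mxE [RHS]mxE (bigD1 0) //= [RHS](bigD1 ord_max) //= !big1 ?addr0 => [|i ne|i ne].
- rewrite !mxE /= eqxx !mulr1 -antitr_exp mxE -(trmxK A) -[in RHS](trmxK A).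
  have tr_exp t' : (A^T) ^+ t' = (A ^+ t')^T.
    elim: t' => [|t' IHt']; first by rewrite !expr0 trmx1.
    by rewrite exprS exprSr -!mulmxE trmx_mul IHt'.
  rewrite !trmxK tr_exp mxE; congr ((A ^+ _) _ _); apply: val_inj => //=.
    by rewrite subn1.
  by have := ltn_ord a; lia.
- rewrite mxE (_ : (i : nat) == n.-1 = false) ?mulr0 //.
  by apply: contraNF ne => /eqP e; apply/eqP/val_inj.
- by rewrite mxE -[_ == _]/(i == 0) (negPf ne) mulr0.
Qed.

Lemma u_tilde_antitr (T : box lam -> nat) (A : 'M[k]_n) :
  u_tilde T (antitr A) = shape_sgn k p lam * v_tilde T A.
Proof.
rewrite /u_tilde /shape_sgn /v_tilde -big_split; apply: eq_bigr => j _ /=.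
rewrite -(column_size lam_part lam_size T) u_col_antitr //.
by rewrite (column_size lam_part lam_size) leqW // col_len_le.
Qed.

Local Notation tau := (@closure_antitr_fun k n mu mu_part).
Local Notation u S := (restr C (u_tilde (ssyt_entry S)) : C -> k^o).
Local Notation v S := (restr C (v_tilde (ssyt_entry S)) : C -> k^o).
Local Notation eps := (shape_sgn k p lam).

Lemma u_tau (S : ssyt lam m) : u S \o tau = eps *: v S.
Proof. by apply/funext => A; rewrite /restr /= u_tilde_antitr. Qed.

Lemma v_tau (S : ssyt lam m) : v S \o tau = eps^-1 *: u S.
Proof.
apply/funext => A; have /(congr1 (fun h : C -> k^o => h (tau A))) := u_tau S.
rewrite /= closure_antitr_funK /GRing.scale /= /GRing.scale /= => ->.
by rewrite mulKf // shape_sgn_neq0.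
Qed.

Lemma semi_scale chi (c : k) (f : C -> k^o) :
  semi_invariants k n mu chi f -> semi_invariants k n mu chi (c *: f).
Proof.
case=> [[P PE] fU fD]; split.
- exists (c *: P) => A; by rewrite /peval mevalZ /GRing.scale /= PE.
- by move=> g gU; rewrite -[in RHS](fU g gU).
- move=> s sD; rewrite scalerA mulrC -scalerA -fD //.
Qed.

Theorem v_basis :
  is_basis (semi_invariants k n mu (bracket (part_weight n lam) (part_weight n [:: r])))
    (fun S : ssyt lam m => v S).
Proof.
have [uW uI uS] := u_basis k p_gt0 mu_part lam_part lam_size.
have eps_nz := shape_sgn_neq0 k p lam.
have sum_tau (b : ssyt lam m -> C -> k^o) (c : ssyt lam m -> k) :
    (\sum_S c S *: b S) \o tau = \sum_S c S *: (b S \o tau).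
  by apply/funext => A /=; rewrite !fct_sumE; apply: eq_bigr.
split=> [S|c c0 S|f Wf].
- have -> : v S = eps^-1 *: (u S \o tau) by rewrite u_tau scalerA mulVf // scale1r.
  by apply: semi_scale; apply: semi_antitr; apply: uW.
- have /uI /(_ S) /eqP : \sum_S (c S * eps^-1) *: u S = 0.
    have := congr1 (fun h : C -> k^o => h \o tau) c0; rewrite /= sum_tau => E.
    by apply: etrans E; apply: eq_bigr => S' _; rewrite v_tau scalerA.
  by rewrite mulf_eq0 invr_eq0 (negPf eps_nz) orbF => /eqP.
have [c cE] := uS _ (semi_antitr mu_part Wf).
exists (fun S => c S * eps).
have -> : f = (f \o tau) \o tau by apply/funext => A /=; rewrite closure_antitr_funK.
rewrite cE sum_tau; apply: eq_bigr => S _.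
by rewrite u_tau scalerA.
Qed.

End VBasis.

Lemma basis_nonzero (k : fieldType) (V : lmodType k) (W : set V) (I : finType) (b : I -> V) :
  is_basis W b -> (exists2 f, W f & f <> 0) <-> inhabited I.
Proof.
case=> bW bI bS; split=> [[f Wf f_nz]|[i]].
  case: (pickP (predT : pred I)) => [i _|none]; first by constructor.
  by case: f_nz; have [c ->] := bS f Wf; apply: big_pred0.
exists (b i) => // bi0.
have E : \sum_j ((j == i)%:R : k) *: b j = 0.
  by rewrite (bigD1 i) //= bi0 scaler0 add0r big1 // => j /negPf ->; rewrite scale0r.
by have /eqP := bI _ E i; rewrite eqxx oner_eq0.
Qed.

Theorem theorem3 (k : closedFieldType) (n : nat) (mu lam : seq nat) (r : nat)
    (n_ge2 : (2 <= n)%N)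
    (mu_part : is_partition n mu)
    (lam_part : is_partition r lam)
    (lam_length : (size lam <= n - 1)%N) :
  let C := orbit_closure k n mu in
  let m := (head 0 mu - 1)%N in
  let wr := part_weight n [:: r] in
  let wlam := part_weight n lam in
  let Wu : set (C -> k^o) := semi_invariants k n mu (bracket wr wlam) in
  let Wv : set (C -> k^o) := semi_invariants k n mu (bracket wlam wr) in
  [/\ (exists2 f, Wu f & f <> 0%R) <-> (size lam <= m)%N,
      (exists2 f, Wv f & f <> 0%R) <-> (size lam <= m)%N,
      is_basis Wu
        (fun T : ssyt lam m => restr C (u_tilde (ssyt_entry T))) &
      is_basis Wv
        (fun T : ssyt lam m => restr C (v_tilde (ssyt_entry T)))].
Proof.
case: n n_ge2 mu_part lam_length => // p; rewrite ltnS subn1 => p_gt0 mu_part lam_size.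
have ssytP m : inhabited (ssyt lam m) <-> (size lam <= m)%N.
  split=> [[S]|]; first exact: (ssyt_size lam_part lam_size S).
  exact: (ssyt_exists lam_part lam_size).
rewrite subn1; have bu := u_basis k p_gt0 mu_part lam_part lam_size.
have bv := v_basis k p_gt0 mu_part lam_part lam_size.
split=> //; apply: iff_trans (ssytP _).
  exact: (basis_nonzero bu).
exact: (basis_nonzero bv).
Qed.
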